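(* Let $n\ge1$ and let $\Lambda$ be an $n$-representation infinite algebra over a field $K$. Then $\mathsf{ind}(\mathscr{P}\vee\mathscr{I})$ is an infinite set of isomorphism classes of indecomposable $\Lambda$-modules such that $\operatorname{Ext}^i_\Lambda(X,Y)=0$ for any $i$ with $0<i<n$ and any $X,Y\in\mathsf{ind}(\mathscr{P}\vee\mathscr{I})$.
   Context: $D=\operatorname{Hom}_K(-,K)$; algebras are nonzero; modules are left modules. For a finite dimensional $K$-algebra $\Lambda$ with $\operatorname{gl.dim}\Lambda\le n$, let $\nu=D\mathbf{R}\operatorname{Hom}_\Lambda(-,\Lambda)$ on $\mathsf{D}^{b}(\mathsf{mod}\,\Lambda)$ (an autoequivalence) and $\nu_n:=\nu\circ[-n]$; $\mathsf{mod}\,\Lambda\subset\mathsf{D}^b(\mathsf{mod}\,\Lambda)$ as complexes with cohomology concentrated in degree $0$. $\Lambda$ is $n$-representation infinite if $\operatorname{gl.dim}\Lambda\le n$ and $\nu_n^{-i}(\Lambda)\in\mathsf{mod}\,\Lambda$ for all $i\ge0$ (then also $\nu_n^i(D\Lambda)\in\mathsf{mod}\,\Lambda$ for all $i\ge0$). $\mathsf{add}\,\mathscr{X}$: direct summands of finite direct sums of objects of $\mathscr{X}$; $\mathsf{ind}\,\mathscr{X}$: isomorphism classes of indecomposable objects; $\mathscr{X}\vee\mathscr{Y}:=\mathsf{add}(\mathsf{ind}\,\mathscr{X}\cup\mathsf{ind}\,\mathscr{Y})$. $\mathscr{P}=\mathsf{add}\{\nu_n^{-i}(\Lambda)\mid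 i\ge0\}$ and $\mathscr{I}=\mathsf{add}\{\nu_n^{i}(D\Lambda)\mid i\ge0\}$. *)

(* Defs.v *)
From HB Require Import structures.
From mathcomp Require Import all_boot all_order all_algebra all_field.

Set Implicit Arguments.
Unset Strict Implicit.
Unset Printing Implicit Defensive.

Import GRing.Theory Num.Theory.
Local Open Scope ring_scope.

Lemma linfun_linearE (K : fieldType) (V W : vectType K) (f : V -> W) :
  linear f -> linfun f =1 f.
Proof.
move=> fL x.
pose F : {linear V -> W} := HB.pack f
  (GRing.isSemilinear.Build K V W _ f (GRing.semilinear_linear fL)).
exact: (lfunE F).
Qed.

Record lmod (K : fieldType) (A : falgType K) := LMod {
  lcar :> vectType K;
  lact : A -> 'End(lcar);
  lact_linear : linear lact;
  lact1 : lact 1 = \1%VF;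
  lactM : forall a b, lact (a * b) = (lact a \o lact b)%VF }.

Record rmod (K : fieldType) (A : falgType K) := RMod {
  rcar :> vectType K;
  ract : A -> 'End(rcar);
  ract_linear : linear ract;
  ract1 : ract 1 = \1%VF;
  ractM : forall a b, ract (a * b) = (ract b \o ract a)%VF }.

Arguments LMod {K A}.
Arguments RMod {K A}.

Section Modules.
Context {K : fieldType} {A : falgType K}.
Implicit Types M N : lmod A.

Definition is_hom M N (f : 'Hom(M, N)) : Prop :=
  forall a x, f (lact M a x) = lact N a (f x).

Definition mod_iso M N : Prop :=
  exists2 f : 'Hom(M, N), is_hom f & bijective f.

Definition is_zero M : Prop := \dim {:M} = 0%N.

Lemma zero_mod_act1 : (0 : 'End('rV[K]_0)) = \1%VF.
Proof. by apply/lfunP => x; rewrite zero_lfunE id_lfunE [x]thinmx0. Qed.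

Lemma zero_mod_actM : A -> A -> (0 : 'End('rV[K]_0)) = ((0 : 'End('rV[K]_0)) \o 0)%VF.
Proof. by move=> _ _; rewrite comp_lfun0l. Qed.

Lemma zero_mod_linear : linear (fun _ : A => 0 : 'End('rV[K]_0)).
Proof. by move=> k a b; rewrite scaler0 addr0. Qed.

Definition zero_mod : lmod A :=
  LMod 'rV[K]_0 _ zero_mod_linear zero_mod_act1 zero_mod_actM.

Definition dsum_act M N (a : A) : 'End((M * N)%type) :=
  linfun (fun u : M * N => (lact M a u.1, lact N a u.2)).

Lemma dsum_actE M N (a : A) (u : (M * N)%type) : dsum_act M N a u = (lact M a u.1, lact N a u.2).
Proof.
by rewrite linfun_linearE // => k x y /=; rewrite !linearP.
Qed.

Lemma dsum_act_linear M N : linear (dsum_act M N).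
Proof.
move=> k a b; apply/lfunP => u.
by rewrite !lfunE /= scale_lfunE !dsum_actE !lact_linear !lfunE /= !lfunE.
Qed.

Lemma dsum_act1 M N : dsum_act M N 1 = \1%VF.
Proof. by apply/lfunP => -[x y]; rewrite dsum_actE !lact1 !lfunE. Qed.

Lemma dsum_actM M N a b :
  dsum_act M N (a * b) = (dsum_act M N a \o dsum_act M N b)%VF.
Proof.
by apply/lfunP => u; rewrite comp_lfunE !dsum_actE !lactM !comp_lfunE.
Qed.

Definition dsum M N : lmod A :=
  LMod (M * N)%type _ (@dsum_act_linear M N) (dsum_act1 M N) (@dsum_actM M N).

Definition bigdsum (m : nat) (F : 'I_m -> lmod A) : lmod A :=
  \big[dsum/zero_mod]_(i < m) F i.

Definition is_projective M : Prop :=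
  forall (N N' : lmod A) (p : 'Hom(N, N')) (f : 'Hom(M, N')),
    is_hom p -> limg p = fullv -> is_hom f ->
    exists2 g : 'Hom(M, N), is_hom g & f = (p \o g)%VF.

Definition indecomposable M : Prop :=
  ~ is_zero M /\
  forall N N' : lmod A, mod_iso M (dsum N N') -> is_zero N \/ is_zero N'.

Lemma lreg_act1 : amull (1 : A) = \1%VF.
Proof. exact: amull1. Qed.

Lemma lreg_actM (a b : A) : amull (a * b) = (amull a \o amull b)%VF.
Proof. exact: amullM. Qed.

Definition lreg : lmod A := LMod A _ (@amull_is_linear K A) lreg_act1 lreg_actM.

Lemma rreg_act1 : amulr (1 : A) = \1%VF.
Proof. by apply/lfunP => x; rewrite !lfunE /= mulr1. Qed.

Lemma rreg_actM (a b : A) : amulr (a * b) = (amulr b \o amulr a)%VF.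
Proof. by apply/lfunP => x; rewrite !lfunE /= !lfunE /= mulrA. Qed.

Definition rreg : rmod A := RMod A _ (@amulr_is_linear K A) rreg_act1 rreg_actM.

(* [hom_space M N] is [Hom_A(M, N)], see [hom_spaceP]. *)
Definition hom_defect M N (f : 'Hom(M, N)) : 'Hom(A, 'Hom(M, N)) :=
  linfun (fun a => ((f \o lact M a) - (lact N a \o f))%VF).

Definition hom_space M N : {vspace 'Hom(M, N)} := lker (linfun (@hom_defect M N)).

Lemma hom_defectE M N f a :
  @hom_defect M N f a = ((f \o lact M a) - (lact N a \o f))%VF.
Proof.
rewrite linfun_linearE // => k b c; rewrite !lact_linear.
by rewrite comp_lfunDl comp_lfunDr -comp_lfunZl -comp_lfunZr scalerBr opprD addrACA.
Qed.

Lemma hom_spaceP M N (f : 'Hom(M, N)) : reflect (is_hom f) (f \in hom_space M N).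
Proof.
have defL : linear (@hom_defect M N).
  move=> k g h; apply/lfunP => a; rewrite !(lfunE, hom_defectE) /=.
  rewrite scale_lfunE !hom_defectE comp_lfunDl comp_lfunDr.
  by rewrite -comp_lfunZl -comp_lfunZr scalerBr opprD addrACA.
rewrite memv_ker linfun_linearE //; apply: (iffP eqP) => [f0 a x | fH].
  have /lfunP/(_ a) := f0; rewrite hom_defectE zero_lfunE => /lfunP/(_ x).
  rewrite zero_lfunE add_lfunE opp_lfunE !comp_lfunE => /eqP.
  by rewrite subr_eq0 => /eqP.
apply/lfunP => a; apply/lfunP => x; rewrite hom_defectE !zero_lfunE.
by rewrite add_lfunE opp_lfunE !comp_lfunE fH subrr.
Qed.

Definition homA M : vectType K := subvs_of (hom_space M lreg).

Lemma homA_precomp M N (f : 'Hom(M, N)) (g : homA N) :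
  is_hom f -> (vsval g \o f)%VF \in hom_space M lreg.
Proof.
move=> fH; apply/hom_spaceP => a x; rewrite !comp_lfunE fH.
exact: (hom_spaceP _ (subvsP g)).
Qed.

Lemma homA_postcomp M (g : homA M) (a : A) :
  (amulr a \o vsval g)%VF \in hom_space M lreg.
Proof.
apply/hom_spaceP => b x; rewrite !comp_lfunE (hom_spaceP _ (subvsP g)).
by rewrite !lfunE /= mulrA.
Qed.

Definition homA_act M (a : A) : 'End(homA M) :=
  linfun (fun g : homA M => vsproj (hom_space M lreg) (amulr a \o vsval g)%VF).

Lemma homA_actE M (a : A) (g : homA M) :
  vsval (homA_act M a g) = (amulr a \o vsval g)%VF.
Proof.
rewrite linfun_linearE; first by rewrite vsprojK ?homA_postcomp.
by move=> k u v; rewrite linearP /= comp_lfunDr -comp_lfunZr linearP.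
Qed.

Lemma homA_act_linear M : linear (homA_act M).
Proof.
move=> k a b; apply/lfunP => g; apply: subvs_inj.
rewrite add_lfunE scale_lfunE linearP !homA_actE linearP /=.
by rewrite comp_lfunDl -comp_lfunZl !homA_actE.
Qed.

Lemma homA_act1 M : homA_act M 1 = \1%VF.
Proof.
apply/lfunP => g; apply: subvs_inj; rewrite homA_actE id_lfunE.
by rewrite rreg_act1 comp_lfun1l.
Qed.

Lemma homA_actM M a b : homA_act M (a * b) = (homA_act M b \o homA_act M a)%VF.
Proof.
apply/lfunP => g; apply: subvs_inj.
by rewrite comp_lfunE !homA_actE rreg_actM comp_lfunA.
Qed.

Definition hom_to_A M : rmod A :=
  RMod (homA M) _ (@homA_act_linear M) (homA_act1 M) (@homA_actM M).

Definition dual_car (V : rmod A) : vectType K := 'Hom(V, K^o).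

Definition dual_act (V : rmod A) (a : A) : 'End(dual_car V) :=
  linfun (fun phi : dual_car V => (phi \o ract V a)%VF).

Lemma dual_actE (V : rmod A) (a : A) (phi : dual_car V) :
  dual_act V a phi = (phi \o ract V a)%VF.
Proof.
by rewrite linfun_linearE // => k u v; rewrite comp_lfunDl -comp_lfunZl.
Qed.

Lemma dual_act_linear (V : rmod A) : linear (dual_act V).
Proof.
move=> k a b; apply/lfunP => phi; rewrite add_lfunE scale_lfunE !dual_actE.
by rewrite ract_linear comp_lfunDr -comp_lfunZr.
Qed.

Lemma dual_act1 (V : rmod A) : dual_act V 1 = \1%VF.
Proof. by apply/lfunP => phi; rewrite dual_actE ract1 comp_lfun1r id_lfunE. Qed.

Lemma dual_actM (V : rmod A) a b :
  dual_act V (a * b) = (dual_act V a \o dual_act V b)%VF.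
Proof.
by apply/lfunP => phi; rewrite comp_lfunE !dual_actE ractM comp_lfunA.
Qed.

Definition dual (V : rmod A) : lmod A :=
  LMod (dual_car V) _ (@dual_act_linear V) (dual_act1 V) (@dual_actM V).

(* [D Hom_A(M, A)], with the left action [(a phi)(f) = phi(f a)], where
   [(f a)(x) = f(x) a]. *)
Definition nak M : lmod A := dual (hom_to_A M).

Definition hom_to_A_map M N (f : 'Hom(M, N)) : 'Hom(hom_to_A N, hom_to_A M) :=
  linfun (fun g : homA N => vsproj (hom_space M lreg) (vsval g \o f)%VF).

Definition dual_map (V W : rmod A) (f : 'Hom(V, W)) : 'Hom(dual W, dual V) :=
  linfun (fun phi : dual_car W => (phi \o f)%VF).

Definition nak_map M N (f : 'Hom(M, N)) : 'Hom(nak M, nak N) :=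
  dual_map (hom_to_A_map f).

Lemma hom_to_A_mapE M N (f : 'Hom(M, N)) (g : homA N) :
  is_hom f -> vsval (hom_to_A_map f g : homA M) = (vsval g \o f)%VF.
Proof.
move=> fH; rewrite linfun_linearE; first by rewrite vsprojK ?homA_precomp.
by move=> k u v; rewrite linearP /= comp_lfunDl -comp_lfunZl linearP.
Qed.

Lemma dual_mapE (V W : rmod A) (f : 'Hom(V, W)) (phi : dual W) :
  dual_map f phi = ((phi : dual_car W) \o f)%VF.
Proof.
by rewrite linfun_linearE // => k u v; rewrite comp_lfunDl -comp_lfunZl.
Qed.

Lemma nak_map_hom M N (f : 'Hom(M, N)) : is_hom f -> is_hom (nak_map f).
Proof.
move=> fH a phi; rewrite /nak_map dual_mapE.
rewrite [lact _ a _]dual_actE [lact _ a _]dual_actE dual_mapE -!comp_lfunA.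
congr (_ \o _)%VF; apply/lfunP => g; rewrite !comp_lfunE; apply: subvs_inj.
by rewrite homA_actE !hom_to_A_mapE // homA_actE comp_lfunA.
Qed.

Lemma nak_map0 M N : nak_map (0 : 'Hom(M, N)) = 0.
Proof.
apply/lfunP => phi; rewrite zero_lfunE dual_mapE; apply/lfunP => g.
rewrite comp_lfunE zero_lfunE.
suff -> : hom_to_A_map (0 : 'Hom(M, N)) g = 0 by rewrite linear0.
apply: subvs_inj; rewrite hom_to_A_mapE ?comp_lfun0r ?linear0 //.
by move=> a x; rewrite !zero_lfunE linear0.
Qed.

Lemma nak_map_comp M N (L : lmod A) (g : 'Hom(N, L)) (f : 'Hom(M, N)) :
  is_hom g -> is_hom f -> nak_map (g \o f)%VF = (nak_map g \o nak_map f)%VF.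
Proof.
move=> gH fH; apply/lfunP => phi; rewrite comp_lfunE !dual_mapE -comp_lfunA.
congr (_ \o _)%VF; apply/lfunP => h; rewrite comp_lfunE; apply: subvs_inj.
rewrite !hom_to_A_mapE ?comp_lfunA // => a x.
by rewrite !comp_lfunE fH gH.
Qed.

Lemma is_zeroP M : is_zero M <-> forall x : M, x = 0.
Proof.
rewrite /is_zero; split => [/eqP|M0]; last first.
  by apply/eqP; rewrite dimv_eq0 -subv0; apply/subvP => x _; rewrite (M0 x) mem0v.
by rewrite dimv_eq0 => /eqP M0 x; apply/eqP; rewrite -memv0 -M0 memvf.
Qed.

Lemma nak_zero M : is_zero M -> is_zero (nak M).
Proof.
move=> /is_zeroP M0; apply/is_zeroP => phi; apply/lfunP => g.
suff -> : g = 0 by rewrite !linear0.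
by apply: subvs_inj; apply/lfunP => x; rewrite (M0 x) !linear0.
Qed.

End Modules.

Arguments zero_mod {K} A.
Arguments lreg {K} A.
Arguments rreg {K} A.

(* Cochain complexes.  The differentials are given between all pairs of degrees
   and vanish unless the target degree is the successor of the source degree, so
   that shifting needs no transport along equalities between degrees. *)
Record complex (K : fieldType) (A : falgType K) := Complex {
  cobj :> int -> lmod A;
  cdiff : forall i j, 'Hom(cobj i, cobj j);
  cdiff_hom : forall i j, is_hom (cdiff i j);
  cdiff_shape : forall i j, j != i + 1 -> cdiff i j = 0;
  cdiff_comp : forall i j k, (cdiff j k \o cdiff i j)%VF = 0 }.

Arguments Complex {K A}.

Definition bounded (K : fieldType) (A : falgType K) (X : complex A) : Prop :=
  exists b : nat, forall i : int, (b < `|i|)%N -> is_zero (X i).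

(* The objects of the bounded derived category of finite dimensional modules. *)
Record Db (K : fieldType) (A : falgType K) := MkDb {
  Db_complex :> complex A;
  Db_bounded : bounded Db_complex }.

Section Complexes.
Context {K : fieldType} {A : falgType K}.
Implicit Types X Y P : complex A.
Implicit Types M N : lmod A.

Record chain_map X Y := ChainMap {
  cmap :> forall i, 'Hom(X i, Y i);
  cmap_hom : forall i, is_hom (cmap i);
  cmap_diff : forall i j, (cmap j \o cdiff X i j = cdiff Y i j \o cmap i)%VF }.

Definition cycles X (i : int) : {vspace X i} := lker (cdiff X i (i + 1)).
Definition boundaries X (i : int) : {vspace X i} := limg (cdiff X (i - 1) i).

(* The induced map on cohomology is injective and surjective in every degree. *)
Definition quasi_iso X Y (f : chain_map X Y) : Prop :=
  forall i : int,
    (cycles X i :&: (f i @^-1: boundaries Y i) <= boundaries X i)%VS /\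
    (cycles Y i <= (f i @: cycles X i) + boundaries Y i)%VS.

(* [H^i(X) = 0]. *)
Definition acyclic_at X (i : int) : Prop := (cycles X i <= boundaries X i)%VS.

Definition stalk_obj M (i : int) : lmod A :=
  match i with Posz 0 => M | _ => zero_mod A end.

Lemma zero_is_hom M N : is_hom (0 : 'Hom(M, N)).
Proof. by move=> a x; rewrite !zero_lfunE linear0. Qed.

Definition stalk_complex M : complex A.
Proof.
refine (Complex (stalk_obj M) (fun i j => 0) _ _ _) => [i j|//|i j k].
- exact: zero_is_hom.
- exact: comp_lfun0l.
Defined.

Lemma stalk_bounded M : bounded (stalk_complex M).
Proof. by exists 0%N => -[[|i]|i] // _; apply/is_zeroP => x; rewrite [x]thinmx0. Qed.

Definition stalk M : Db A := MkDb (stalk_bounded M).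

Definition shift_complex X (k : int) : complex A.
Proof.
refine (Complex (fun i => X (i + k))
  (fun i j => (-1) ^+ `|k|%N *: cdiff X (i + k) (j + k)) _ _ _).
- by move=> i j a x; rewrite !scale_lfunE cdiff_hom linearZ.
- move=> i j neq; rewrite cdiff_shape ?scaler0 //.
  by apply: contraNneq neq => e; apply/eqP/(addIr k); rewrite e addrAC.
- by move=> i j l; rewrite -comp_lfunZl -comp_lfunZr cdiff_comp !scaler0.
Defined.

Lemma shift_bounded X k : bounded X -> bounded (shift_complex X k).
Proof.
move=> [b Xb]; exists (b + `|k|)%N => i lt_i; apply: Xb.
by rewrite -(ltn_add2r `|k|%N) (leq_trans lt_i) // -lez_nat PoszD !abszE
  -{1}[i](addrK k) ler_normB.
Qed.

Definition shift (X : Db A) (k : int) : Db A :=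
  MkDb (shift_bounded k (Db_bounded X)).

Definition nak_complex X : complex A.
Proof.
refine (Complex (fun i => nak (X i)) (fun i j => nak_map (cdiff X i j)) _ _ _).
- by move=> i j; apply/nak_map_hom/cdiff_hom.
- by move=> i j neq; rewrite cdiff_shape ?nak_map0.
- move=> i j k; rewrite -nak_map_comp; try exact: cdiff_hom.
  by rewrite cdiff_comp nak_map0.
Defined.

Lemma nak_bounded X : bounded X -> bounded (nak_complex X).
Proof. by move=> [b Xb]; exists b => i /Xb/nak_zero. Qed.

Definition nakD (X : Db A) : Db A := MkDb (nak_bounded (Db_bounded X)).

(* The isomorphisms of the localization at quasi-isomorphisms are the roofs both
   of whose legs are quasi-isomorphisms. *)
Definition Db_iso (X Y : Db A) : Prop :=
  exists (Z : Db A) (f : chain_map Z X) (g : chain_map Z Y),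
    quasi_iso f /\ quasi_iso g.

(* [Y] is isomorphic to [nu X] in the derived category: [RHom_A(X, A)] is
   computed on a bounded complex of projectives quasi-isomorphic to [X]. *)
Definition is_nu (X Y : Db A) : Prop :=
  exists (P : Db A) (f : chain_map P X),
    [/\ forall i, is_projective (P i), quasi_iso f & Db_iso (nakD P) Y].

Definition is_nu_n (n : nat) (X Y : Db A) : Prop := is_nu (shift X (- n%:Z)) Y.

(* [Y] is isomorphic to the [i]-th iterate of [nu_n] applied to [X]. *)
Fixpoint is_nu_n_iter (n i : nat) (X Y : Db A) : Prop :=
  if i is i'.+1 then exists2 Z : Db A, is_nu_n n X Z & is_nu_n_iter n i' Z Y
  else Db_iso X Y.

(* [nu_n] is an autoequivalence when the global dimension is finite; [Y] is
   isomorphic to the [i]-th iterate of its quasi-inverse applied to [X]. *)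
Definition is_nu_n_inv_iter (n i : nat) (X Y : Db A) : Prop :=
  is_nu_n_iter n i Y X.

Definition in_mod (X : Db A) : Prop := forall i : int, i != 0 -> acyclic_at X i.

Definition proj_resolution (P : complex A) M : Prop :=
  [/\ forall i : int, is_projective (P i),
      forall i : int, 0 < i -> is_zero (P i)
    & exists f : chain_map P (stalk M), quasi_iso f].

(* [Ext^i_A(M, N) = 0]: for a projective resolution [P] of [M], every
   [i]-cocycle of the complex [Hom_A(P, N)] is a coboundary. *)
Definition Ext_vanishes (i : nat) M N : Prop :=
  forall P : complex A, proj_resolution P M ->
  forall f : 'Hom(P (- i%:Z), N), is_hom f ->
    (f \o cdiff P (- i%:Z - 1) (- i%:Z))%VF = 0 ->
  exists2 g : 'Hom(P (- i%:Z + 1), N),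
    is_hom g & f = (g \o cdiff P (- i%:Z) (- i%:Z + 1))%VF.

End Complexes.

Definition gldim_le (K : fieldType) (A : falgType K) (n : nat) : Prop :=
  forall M : lmod A, exists P : complex A,
    proj_resolution P M /\ forall i : int, i < - n%:Z -> is_zero (P i).

Definition n_representation_infinite
    (K : fieldType) (A : falgType K) (n : nat) : Prop :=
  gldim_le A n /\
  forall i : nat, exists X : Db A,
    is_nu_n_inv_iter n i (stalk (lreg A)) X /\ in_mod X.

(* Classes of modules are plain predicates: [set (lmod A)] from MathComp-Analysis
   is rejected by the universe constraints of [vectType]. *)
Definition mod_class (K : fieldType) (A : falgType K) : Type := lmod A -> Prop.

Section Subcategories.
Context {K : fieldType} {A : falgType K}.
Implicit Types S T C : mod_class A.

Definition add S : mod_class A := fun M =>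
  exists (m : nat) (F : 'I_m -> lmod A) (N : lmod A),
    (forall i, S (F i)) /\ mod_iso (dsum M N) (bigdsum F).

Definition iso_class (M : lmod A) : mod_class A := fun N => mod_iso M N.

Definition ind S : mod_class A -> Prop := fun C =>
  exists M : lmod A, [/\ S M, indecomposable M & C = iso_class M].

Definition vee S T : mod_class A :=
  add (fun M => exists2 C, ind S C \/ ind T C & C M).

End Subcategories.

Definition finite_collection (T : Type) (P : T -> Prop) : Prop :=
  exists (m : nat) (F : 'I_m -> T), forall x, P x -> exists i, F i = x.

Definition preprojectives (K : fieldType) (A : falgType K) (n : nat) : mod_class A :=
  add (fun M => exists i : nat, is_nu_n_inv_iter n i (stalk (lreg A)) (stalk M)).

Definition preinjectives (K : fieldType) (A : falgType K) (n : nat) : mod_class A :=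
  add (fun M => exists i : nat, is_nu_n_iter n i (stalk (dual (rreg A))) (stalk M)).

Arguments preprojectives {K} A n.
Arguments preinjectives {K} A n.

(* Main.v *)
Require Import Defs.
From HB Require Import structures.
From mathcomp Require Import all_boot all_order all_algebra all_field.
From mathcomp Require Import zify.
From Stdlib Require Import ClassicalEpsilon.

Set Implicit Arguments.
Unset Strict Implicit.
Unset Printing Implicit Defensive.

Import Order.TTheory GRing.Theory Num.Theory.
Local Open Scope ring_scope.

(** Write [nu_n X = nu (X[-n])] and let Lambda be the regular module.  Everything
    follows from vanishing statements [Hom(X, Y[j]) = 0] in the derived category
    between members of the orbit [nu_n^z Lambda], [z] an integer.  Up to shift the
    orbit contains the generators of P, which are the [nu_n^-i Lambda], and those
    of I, because [D Lambda = nu Lambda = (nu_n Lambda)[n]].  Two tools move such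
    a statement along the orbit: [nu_n] is fully faithful, and Serre duality gives
    [Hom(X, Y) = D Hom(Y, nu X)].  For [b <= a] they reduce
    [Hom(nu_n^a Lambda, nu_n^b Lambda[j])] to the cohomology
    [H^j(nu_n^(b - a) Lambda)], which is zero for [j <> 0] by assumption; for
    [a < b] the space is dual to
    [Hom(nu_n^b Lambda, nu_n^(a + 1) Lambda[n - j])], hence zero for [j <> n].
    Both apply when [0 < j < n], and shifting by [n] whenever a member of I occurs
    covers the mixed cases ([preproj_preproj_vanish], [preproj_preproj_vanish_gt],
    [preproj_preinj_vanish], [preinj_preproj_vanish], [preinj_preinj_vanish]).
    Vanishing of [Ext] then passes to direct sums and summands ([generated_Dhom0]).

    For infinitude take [j = 0] in the second case: there are no nonzero maps from
    [nu_n^-a Lambda] to [nu_n^-b Lambda] when [b < a], so these nonzero modules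
    have pairwise no indecomposable summand in common ([no_common_summand]).

    The derived category enters only through the relation [Dvanish X Y]: every
    chain map to [Y] from a projective resolution of [X] is null-homotopic.  The
    comparison theorem ([lift_null], [lift_map]) makes it invariant under
    quasi-isomorphism.  Serre duality ([serre_duality]) compares null-homotopic
    maps [P -> Y] and [Y -> nu P] for a bounded complex [P] of projectives; it is
    finite-dimensional linear duality ([bexact_dual]) for the trace pairing of
    [Hom(P i, Y j)] with [Hom(Y j, nu (P i))].  Full faithfulness of [nu_n] is
    Serre duality applied twice ([nu_n_full], [nu_n_faithful]).  The backward
    direction of duality needs a projective resolution of the second argument.
    Resolutions are available because the orbit objects are, up to
    quasi-isomorphism, modules ([acyc_qiso_stalk]), and those have finite
    resolutions. *)

(** * Modules: homomorphisms, submodules, quotients, projectives *)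

Section ModuleTools.
Context {K : fieldType} {A : falgType K}.
Implicit Types M N L P : lmod A.

Lemma hom_comp M N L (g : 'Hom(N, L)) (f : 'Hom(M, N)) :
  is_hom g -> is_hom f -> is_hom (g \o f)%VF.
Proof. by move=> gH fH a x; rewrite !comp_lfunE fH gH. Qed.

Lemma hom_id M : is_hom (\1%VF : 'Hom(M, M)).
Proof. by move=> a x; rewrite !id_lfunE. Qed.

Lemma hom_add M N (f g : 'Hom(M, N)) : is_hom f -> is_hom g -> is_hom (f + g).
Proof. by move=> fH gH a x; rewrite !add_lfunE fH gH linearD. Qed.

Lemma hom_scale M N k (f : 'Hom(M, N)) : is_hom f -> is_hom (k *: f).
Proof. by move=> fH a x; rewrite !scale_lfunE fH linearZ. Qed.

Lemma hom_opp M N (f : 'Hom(M, N)) : is_hom f -> is_hom (- f).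
Proof. by rewrite -scaleN1r; apply: hom_scale. Qed.

Lemma hom_sub M N (f g : 'Hom(M, N)) : is_hom f -> is_hom g -> is_hom (f - g).
Proof. by move=> fH gH; apply: hom_add => //; apply: hom_opp. Qed.

Lemma hom_sum M N (I : finType) (Q : pred I) (f : I -> 'Hom(M, N)) :
  (forall i, is_hom (f i)) -> is_hom (\sum_(i | Q i) f i).
Proof.
move=> fH; apply: (big_ind (fun f : 'Hom(M, N) => is_hom f)) => // [|f1 f2].
  exact: zero_is_hom.
exact: hom_add.
Qed.

Lemma hom_zero_dom M N (f : 'Hom(M, N)) : is_zero M -> f = 0.
Proof. by move=> /is_zeroP M0; apply/lfunP => x; rewrite (M0 x) !linear0. Qed.

Lemma hom_zero_cod M N (f : 'Hom(M, N)) : is_zero N -> f = 0.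
Proof. by move=> /is_zeroP N0; apply/lfunP => x; rewrite zero_lfunE (N0 (f x)). Qed.

Lemma zero_mod_zero : is_zero (zero_mod A).
Proof. by apply/is_zeroP => x; apply: thinmx0. Qed.

Lemma zero_mod_eq0 (x : zero_mod A) : x = 0.
Proof. exact: thinmx0. Qed.

Lemma lact0 M : lact M 0 = 0.
Proof. by rewrite -{1}(subrr (0 : A)) -scaleN1r addrC lact_linear scaleN1r addNr. Qed.

Lemma lactZ M k a : lact M (k *: a) = k *: lact M a.
Proof. by rewrite -[k *: a]addr0 lact_linear lact0 addr0. Qed.

Section Sub.
Variables (N : lmod A) (U : {vspace N}).
Hypothesis UA : forall a x, x \in U -> lact N a x \in U.

Definition sub_act (a : A) : 'End(subvs_of U) :=
  linfun (fun u : subvs_of U => vsproj U (lact N a (vsval u))).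

Lemma sub_actE a (u : subvs_of U) : vsval (sub_act a u) = lact N a (vsval u).
Proof.
rewrite linfun_linearE; first by rewrite vsprojK ?UA ?subvsP.
by move=> k x y; rewrite !linearP.
Qed.

Lemma sub_act_linear : linear sub_act.
Proof.
move=> k a b; apply/lfunP => u; apply: subvs_inj.
rewrite add_lfunE scale_lfunE linearP /= !sub_actE lact_linear.
by rewrite add_lfunE scale_lfunE.
Qed.

Lemma sub_act1 : sub_act 1 = \1%VF.
Proof. by apply/lfunP => u; apply: subvs_inj; rewrite sub_actE lact1 !id_lfunE. Qed.

Lemma sub_actM a b : sub_act (a * b) = (sub_act a \o sub_act b)%VF.
Proof.
apply/lfunP => u; apply: subvs_inj.
by rewrite comp_lfunE !sub_actE lactM comp_lfunE.
Qed.

Definition submod : lmod A := LMod (subvs_of U) _ sub_act_linear sub_act1 sub_actM.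

Definition sub_incl : 'Hom(submod, N) := linfun (@vsval K N U).

Lemma sub_inclE (u : submod) : sub_incl u = vsval (u : subvs_of U).
Proof. by rewrite lfunE. Qed.

Lemma sub_incl_hom : is_hom sub_incl.
Proof. by move=> a u; rewrite !sub_inclE sub_actE. Qed.

Lemma sub_incl_inj : injective sub_incl.
Proof. by move=> u v; rewrite !sub_inclE; apply: subvs_inj. Qed.

Lemma sub_incl_mem (u : submod) : sub_incl u \in U.
Proof. by rewrite sub_inclE subvsP. Qed.

Definition sub_corestr M (f : 'Hom(M, N)) : 'Hom(M, submod) :=
  (linfun (vsproj U) \o f)%VF.

Lemma sub_corestrE M (f : 'Hom(M, N)) x :
  f x \in U -> sub_incl (sub_corestr f x) = f x.
Proof. by move=> fU; rewrite sub_inclE comp_lfunE lfunE /= vsprojK. Qed.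

Lemma sub_corestr_hom M (f : 'Hom(M, N)) :
  is_hom f -> (forall x, f x \in U) -> is_hom (sub_corestr f).
Proof.
move=> fH fU a x; apply: sub_incl_inj.
by rewrite sub_incl_hom !sub_corestrE // fH.
Qed.

Lemma sub_lift (x : N) : x \in U -> exists u : submod, sub_incl u = x.
Proof. by move=> xU; exists (vsproj U x); rewrite sub_inclE vsprojK. Qed.

End Sub.

Section Quotient.
Variables (N : lmod A) (W : vectType K) (q : 'Hom(N, W)).
Hypotheses (q_onto : limg q = fullv)
  (q_ker : forall a x, q x = 0 -> q (lact N a x) = 0).

Lemma quot_secK w : q ((q^-1)%VF w) = w.
Proof. by rewrite limg_lfunVK // q_onto memvf. Qed.

Definition quot_act (a : A) : 'End(W) := (q \o (lact N a \o q^-1))%VF.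

Lemma quot_actE a x : quot_act a (q x) = q (lact N a x).
Proof.
rewrite !comp_lfunE; apply/eqP; rewrite -subr_eq0 -!linearB; apply/eqP.
by apply: q_ker; rewrite linearB /= quot_secK subrr.
Qed.

Lemma quot_act_linear : linear quot_act.
Proof.
move=> k a b; rewrite /quot_act lact_linear comp_lfunDl comp_lfunDr.
by rewrite -comp_lfunZl -comp_lfunZr.
Qed.

Lemma quot_act1 : quot_act 1 = \1%VF.
Proof. by apply/lfunP => w; rewrite -(quot_secK w) quot_actE lact1 !id_lfunE. Qed.

Lemma quot_actM a b : quot_act (a * b) = (quot_act a \o quot_act b)%VF.
Proof.
apply/lfunP => w; rewrite -(quot_secK w) comp_lfunE !quot_actE.
by rewrite lactM comp_lfunE.
Qed.

Definition quotmod : lmod A := LMod W _ quot_act_linear quot_act1 quot_actM.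

Lemma quot_hom : is_hom (q : 'Hom(N, quotmod)).
Proof. by move=> a x; rewrite [RHS]quot_actE. Qed.

End Quotient.

(** The complement of [B] that is the image of [1 - projv B] serves as carrier;
    the action is carried over through the projection. *)
Lemma quotient_exists N (B : {vspace N}) :
  (forall a x, x \in B -> lact N a x \in B) ->
  exists (Q : lmod A) (q : 'Hom(N, Q)),
    [/\ is_hom q, forall w, exists x, w = q x & forall x, (q x == 0) = (x \in B)].
Proof.
move=> BA; pose r : 'End(N) := (\1 - projv B)%VF.
have rker x : (r x == 0) = (x \in B).
  rewrite /r add_lfunE opp_lfunE id_lfunE subr_eq0; apply/eqP/idP => [->|xB].
    exact: memv_proj.
  by rewrite projv_id.
pose q : 'Hom(N, subvs_of (limg r)) := (linfun (vsproj (limg r)) \o r)%VF.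
have qE x : vsval (q x) = r x.
  by rewrite comp_lfunE lfunE /= vsprojK // memv_img ?memvf.
have qsurj w : exists x, w = q x.
  have /memv_imgP[x _ e] := subvsP w; exists x.
  by apply: subvs_inj; rewrite qE.
have q_onto : limg q = fullv.
  apply/eqP; rewrite eqEsubv subvf; apply/subvP => w _.
  by have [x ->] := qsurj w; rewrite memv_img ?memvf.
have qker x : (q x == 0) = (x \in B).
  by rewrite -rker -qE; apply/eqP/eqP => [->|e]; [|apply: subvs_inj; rewrite e].
have q_ker a x : q x = 0 -> q (lact N a x) = 0.
  by move=> /eqP; rewrite qker => /(BA a); rewrite -qker => /eqP.
by exists (quotmod q_onto q_ker), q; split=> //; apply: quot_hom.
Qed.

(** The projective property is stated for epimorphisms; corestricting to the
    image submodule turns it into the lifting criterion used everywhere below. *)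
Lemma projective_lift P N N' (p : 'Hom(N, N')) (f : 'Hom(P, N')) :
  is_projective P -> is_hom p -> is_hom f -> (forall x, exists y, f x = p y) ->
  exists2 g : 'Hom(P, N), is_hom g & f = (p \o g)%VF.
Proof.
move=> projP pH fH fp.
have UA a x : x \in limg p -> lact N' a x \in limg p.
  by case/memv_imgP => y _ ->; rewrite -pH memv_img ?memvf.
have fU x : f x \in limg p by have [y ->] := fp x; rewrite memv_img ?memvf.
have pU x : p x \in limg p by rewrite memv_img ?memvf.
have [||| g gH e] := projP N (submod UA) (sub_corestr UA p) (sub_corestr UA f).
- exact: sub_corestr_hom.
- apply/eqP; rewrite eqEsubv subvf; apply/subvP => w _.
  have /memv_imgP[y _ e] := sub_incl_mem w.
  suff -> : w = sub_corestr UA p y by rewrite memv_img ?memvf.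
  by apply: (@sub_incl_inj _ _ UA); rewrite e sub_corestrE.
- exact: sub_corestr_hom.
exists g => //; apply/lfunP => x.
rewrite -(sub_corestrE UA (fU x)) e !comp_lfunE.
by rewrite -[X in sub_incl _ X]comp_lfunE sub_corestrE.
Qed.

(** ** Direct sums *)

Definition dfst M N : 'Hom(dsum M N, M) := linfun (fun u : M * N => u.1).
Definition dsnd M N : 'Hom(dsum M N, N) := linfun (fun u : M * N => u.2).

Lemma dfstE M N (u : dsum M N) : dfst M N u = u.1.
Proof. by rewrite linfun_linearE. Qed.

Lemma dsndE M N (u : dsum M N) : dsnd M N u = u.2.
Proof. by rewrite linfun_linearE. Qed.

Lemma dfst_hom M N : is_hom (dfst M N).
Proof. by move=> a u; rewrite !dfstE [lact _ a u]dsum_actE. Qed.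

Lemma dsnd_hom M N : is_hom (dsnd M N).
Proof. by move=> a u; rewrite !dsndE [lact _ a u]dsum_actE. Qed.

Definition dpair L M N (f : 'Hom(L, M)) (g : 'Hom(L, N)) : 'Hom(L, dsum M N) :=
  linfun (fun x => (f x, g x) : M * N).

Lemma dpairE L M N (f : 'Hom(L, M)) (g : 'Hom(L, N)) x : dpair f g x = (f x, g x).
Proof. by rewrite linfun_linearE // => k u v; rewrite !linearP. Qed.

Lemma dpair_hom L M N (f : 'Hom(L, M)) (g : 'Hom(L, N)) :
  is_hom f -> is_hom g -> is_hom (dpair f g).
Proof. by move=> fH gH a x; rewrite !dpairE fH gH [RHS]dsum_actE. Qed.

(** ** The regular module and dual bases *)

Lemma lregE (a x : A) : lact (lreg A) a x = a * x.
Proof. by rewrite lfunE. Qed.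

Definition orbit_map M (y : M) : 'Hom(lreg A, M) := linfun (fun a => lact M a y).

Lemma orbit_mapE M (y : M) a : orbit_map y a = lact M a y.
Proof.
rewrite linfun_linearE // => k b c.
by rewrite lact_linear add_lfunE scale_lfunE.
Qed.

Lemma orbit_map_hom M (y : M) : is_hom (orbit_map y).
Proof. by move=> a x; rewrite !orbit_mapE lregE lactM comp_lfunE. Qed.

Lemma hom_lregE M (f : 'Hom(lreg A, M)) a : is_hom f -> f a = lact M a (f (1 : A)).
Proof. by move=> fH; rewrite -fH lregE mulr1. Qed.

Lemma lreg_projective : is_projective (lreg A).
Proof.
move=> N N' p f pH p_onto fH.
have : f (1 : A) \in limg p by rewrite p_onto memvf.
case/memv_imgP => y _ e; exists (orbit_map y); first exact: orbit_map_hom.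
by apply/lfunP => a; rewrite comp_lfunE hom_lregE // e orbit_mapE pH.
Qed.

Section Free.
Variable m : nat.
Local Notation F := {ffun 'I_m -> A}.

Definition free_act (a : A) : 'End(F) := linfun (fun u : F => [ffun i => a * u i]).

Lemma free_actE a (u : F) i : free_act a u i = a * u i.
Proof.
rewrite linfun_linearE ?ffunE // => k v w; apply/ffunP => j.
by rewrite !ffunE mulrDr scalerAr.
Qed.

Lemma free_act_linear : linear free_act.
Proof.
move=> k a b; apply/lfunP => u; apply/ffunP => i.
by rewrite add_lfunE scale_lfunE !ffunE !free_actE mulrDl scalerAl.
Qed.

Lemma free_act1 : free_act 1 = \1%VF.
Proof. by apply/lfunP => u; apply/ffunP => i; rewrite free_actE id_lfunE mul1r. Qed.

Lemma free_actM a b : free_act (a * b) = (free_act a \o free_act b)%VF.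
Proof.
by apply/lfunP => u; apply/ffunP => i; rewrite comp_lfunE !free_actE mulrA.
Qed.

Definition freemod : lmod A := LMod F _ free_act_linear free_act1 free_actM.

Definition free_coord (i : 'I_m) : 'Hom(freemod, lreg A) := linfun (fun u : F => u i).

Lemma free_coordE i (u : freemod) : free_coord i u = (u : F) i.
Proof. by rewrite linfun_linearE // => k v w; rewrite !ffunE. Qed.

Lemma free_coord_hom i : is_hom (free_coord i).
Proof. by move=> a u; rewrite !free_coordE lregE free_actE. Qed.

Definition free_eval M (x : 'I_m -> M) : 'Hom(freemod, M) :=
  \sum_i (orbit_map (x i) \o free_coord i)%VF.

Lemma free_evalE M (x : 'I_m -> M) u :
  free_eval x u = \sum_i lact M ((u : F) i) (x i).
Proof.
rewrite sum_lfunE; apply: eq_bigr => i _.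
by rewrite comp_lfunE orbit_mapE free_coordE.
Qed.

Lemma free_eval_hom M (x : 'I_m -> M) : is_hom (free_eval x).
Proof.
by apply: hom_sum => i; apply: hom_comp; [apply: orbit_map_hom|apply: free_coord_hom].
Qed.

End Free.

(** A section of the epimorphism from the free module on a [K]-basis gives a
    dual basis, which is how projectivity enters the duality below. *)
Lemma dual_basis P : is_projective P ->
  exists s : seq (P * homA P), forall y,
    y = \sum_(p <- s) lact P (vsval p.2 y) p.1.
Proof.
move=> projP; set m := \dim {:P}; pose x (i : 'I_m) : P := (vbasis {:P})`_i.
have surj y : exists u, y = free_eval x u.
  exists [ffun i => (coord (vbasis {:P}) i y)%:A]; rewrite free_evalE.
  rewrite {1}(coord_vbasis (memvf y)); apply: eq_bigr => i _.
  by rewrite ffunE lactZ lact1 scale_lfunE id_lfunE.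
have [//|||g gH e] := @projective_lift P (freemod m) P (free_eval x) \1%VF projP.
- exact: free_eval_hom.
- exact: hom_id.
- by move=> y; have [u ->] := surj y; exists u; rewrite id_lfunE.
have xsP (i : 'I_m) : (free_coord i \o g)%VF \in hom_space P (lreg A).
  by apply/hom_spaceP/hom_comp => //; apply: free_coord_hom.
pose xs i := vsproj (hom_space P (lreg A)) (free_coord i \o g)%VF.
exists [seq (x i, xs i) | i <- enum 'I_m] => y.
rewrite big_map big_enum /= -{1}[y](id_lfunE) e comp_lfunE free_evalE.
by apply: eq_bigr => i _; rewrite vsprojK // comp_lfunE free_coordE.
Qed.

End ModuleTools.

(** * Families indexed by degrees *)

(** A family given on the image of an injection extends by default values; the
    transports along equalities between degrees are confined to this proof. *)
Lemma extend_family (I : Type) (J : eqType) (phi : I -> J) (T : J -> Type)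
    (t : forall i, T (phi i)) (z : forall j, T j) : injective phi ->
  exists t' : forall j, T j, (forall i, t' (phi i) = t i) /\
    forall j, (forall i, phi i <> j) -> t' j = z j.
Proof.
move=> phi_inj.
pose Q j (x : T j) := (forall i (e : phi i = j), x = eq_rect (phi i) T (t i) j e) /\
  ((forall i, phi i <> j) -> x = z j).
have exQ j : exists x, Q j x.
  have [[i e]|no] := classic (exists i, phi i = j); last first.
    by exists (z j); split=> // i e; case: no; exists i.
  subst j; exists (t i); split=> [i' e|/(_ i)//].
  have ei := phi_inj _ _ e; subst i'.
  by rewrite (eq_irrelevance e erefl).
pose t' j := proj1_sig (constructive_indefinite_description _ (exQ j)).
have t'P j : Q j (t' j) := proj2_sig (constructive_indefinite_description _ (exQ j)).
exists t'; split=> [i|j]; first exact: (proj1 (t'P (phi i)) i erefl).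
exact: (proj2 (t'P j)).
Qed.

(** The predicate [Q] records a property, such as being a homomorphism, that the
    extended family has to keep in every degree. *)
Lemma extend_point (J : eqType) (k : J) (T : J -> Type)
    (Q : forall j, T j -> Prop) (t : T k) (z : forall j, T j) :
  Q k t -> (forall j, Q j (z j)) ->
  exists t' : forall j, T j, t' k = t /\ forall j, Q j (t' j).
Proof.
move=> Qt Qz.
have [|t' [t'k t'z]] := @extend_family unit J (fun=> k) T (fun=> t) z.
  by case=> -[].
exists t'; split=> [|j]; first exact: (t'k tt).
have [<-|neq] := classic (k = j); first by rewrite (t'k tt).
by rewrite t'z.
Qed.

(** Descending induction with dependent choice: starting from the default values
    above degree [b], each member is chosen in terms of the one above it. *)
Lemma descending_family (T : int -> Type) (Inv : forall i, T i -> Prop)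
    (R : forall i j, T j -> T i -> Prop) (b : int) (z : forall i, T i) :
  (forall i : int, b <= i -> Inv i (z i)) ->
  (forall i j : int, b <= i -> R i j (z j) (z i)) ->
  (forall (i j : int) (x : T j), j = i + 1 -> Inv j x -> exists y, Inv i y /\ R i j x y) ->
  exists t : forall i, T i, forall i j : int, j = i + 1 -> R i j (t j) (t i).
Proof.
move=> Iz Rz step; pose phi (n : nat) : int := b - n%:Z.
have phiS n : phi n = phi n.+1 + 1 by rewrite /phi; lia.
have z0 : Inv (phi 0%N) (z (phi 0%N)) by apply: Iz; rewrite /phi; lia.
have S n (x : {x : T (phi n) | Inv _ x}) :
    {y : {y : T (phi n.+1) | Inv _ y} | R _ _ (sval x) (sval y)}.
  apply: constructive_indefinite_description.
  by have [y [Iy Ry]] := step _ _ _ (phiS n) (svalP x); exists (exist _ y Iy).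
pose u := nat_rect (fun n => {x : T (phi n) | Inv _ x}) (exist _ _ z0)
  (fun n x => sval (S n x)).
have phi_inj : injective phi by move=> m n; rewrite /phi; lia.
have [t [tu tz]] := extend_family (fun n => sval (u n)) z phi_inj.
have tb i : b <= i -> t i = z i.
  rewrite le_eqVlt => /predU1P[e|lt_bi]; last by apply: tz => n; rewrite /phi; lia.
  have -> : i = phi 0%N by rewrite /phi; lia.
  exact: tu.
exists t => i j e; have [le_bi|lt_ib] := leP b i.
  by rewrite (tb i) // (tb j); [apply: Rz | lia].
have [n [ei ej]] : exists n, i = phi n.+1 /\ j = phi n.
  by exists `|b - i|.-1%N; rewrite /phi; lia.
clear e lt_ib; subst i; subst j; rewrite !tu /=; exact: svalP (S n (u n)).
Qed.

(** * Chain maps, homotopies and quasi-isomorphisms *)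

Section Homotopy.
Context {K : fieldType} {A : falgType K}.
Implicit Types X Y Z P : complex A.

Definition is_chain X Y (f : forall i, 'Hom(X i, Y i)) : Prop :=
  (forall i, is_hom (f i)) /\
  forall i j, (f j \o cdiff X i j = cdiff Y i j \o f i)%VF.

(** Degrees are kept as variables constrained by equations, here and below, so
    that no transport along [i - 1 + 1 = i] is ever needed. *)
Definition null X Y (f : forall i, 'Hom(X i, Y i)) : Prop :=
  exists2 h : forall i j, 'Hom(X i, Y j), (forall i j, is_hom (h i j)) &
    forall i j k : int, j = i + 1 -> i = k + 1 ->
      f i = ((cdiff Y k i \o h i k) + (h j i \o cdiff X i j))%VF.

(** The elementwise form of being a quasi-isomorphism. *)
Definition qis X Y (f : forall i, 'Hom(X i, Y i)) : Prop :=
  (forall i j k : int, j = i + 1 -> i = k + 1 -> forall (x : X i) (y : Y k),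
     cdiff X i j x = 0 -> f i x = cdiff Y k i y -> exists z, x = cdiff X k i z) /\
  (forall i j k : int, j = i + 1 -> i = k + 1 -> forall y : Y i, cdiff Y i j y = 0 ->
     exists x z, cdiff X i j x = 0 /\ y = f i x + cdiff Y k i z).

Definition acyc X (i : int) : Prop := forall j k : int, j = i + 1 -> i = k + 1 ->
  forall x : X i, cdiff X i j x = 0 -> exists y, x = cdiff X k i y.

Lemma cdiffK X i j k x : cdiff X j k (cdiff X i j x) = 0.
Proof. by rewrite -comp_lfunE cdiff_comp zero_lfunE. Qed.

Lemma chainE X Y (f : forall i, 'Hom(X i, Y i)) i j x :
  is_chain f -> f j (cdiff X i j x) = cdiff Y i j (f i x).
Proof. by case=> _ /(_ i j)/lfunP/(_ x); rewrite !comp_lfunE. Qed.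

Lemma chainI X Y (f : forall i, 'Hom(X i, Y i)) :
  (forall i, is_hom (f i)) ->
  (forall i j : int, j = i + 1 -> f j \o cdiff X i j = cdiff Y i j \o f i)%VF ->
  is_chain f.
Proof.
move=> fH fd; split=> // i j; have [/fd//|neq] := eqVneq j (i + 1).
by rewrite !cdiff_shape // comp_lfun0l comp_lfun0r.
Qed.

Lemma cmap_chain X Y (f : chain_map X Y) : is_chain f.
Proof. by split; [apply: cmap_hom | apply: cmap_diff]. Qed.

Definition chain_pack X Y f (fC : @is_chain X Y f) : chain_map X Y :=
  ChainMap (proj1 fC) (proj2 fC).

Lemma chain_id X : @is_chain X X (fun=> \1%VF).
Proof.
by split=> [i|i j]; [apply: hom_id | rewrite comp_lfun1l comp_lfun1r].
Qed.

Lemma chain_comp X Y Z (g : forall i, 'Hom(Y i, Z i)) (f : forall i, 'Hom(X i, Y i)) :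
  is_chain g -> is_chain f -> is_chain (fun i => g i \o f i)%VF.
Proof.
move=> gC fC; split=> [i|i j]; first exact: hom_comp (gC.1 i) (fC.1 i).
by rewrite comp_lfunA -gC.2 -!comp_lfunA fC.2.
Qed.

Lemma chain_sub X Y (f g : forall i, 'Hom(X i, Y i)) :
  is_chain f -> is_chain g -> is_chain (fun i => f i - g i).
Proof.
move=> fC gC; split=> [i|i j]; first exact: hom_sub (fC.1 i) (gC.1 i).
by rewrite comp_lfunDl comp_lfunDr comp_lfunNl comp_lfunNr fC.2 gC.2.
Qed.

Lemma null_compl X Y Z (g : forall i, 'Hom(Y i, Z i)) (f : forall i, 'Hom(X i, Y i)) :
  is_chain g -> null f -> null (fun i => g i \o f i)%VF.
Proof.
move=> gC [h hH fE]; exists (fun i j => g j \o h i j)%VF => [i j|i j k ej ei].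
  exact: hom_comp (gC.1 j) (hH i j).
by rewrite (fE i j k) // comp_lfunDr !comp_lfunA gC.2.
Qed.

Lemma null_compr X Y Z (g : forall i, 'Hom(Y i, Z i)) (f : forall i, 'Hom(X i, Y i)) :
  is_chain f -> null g -> null (fun i => g i \o f i)%VF.
Proof.
move=> fC [h hH gE]; exists (fun i j => h i j \o f i)%VF => [i j|i j k ej ei].
  exact: hom_comp (hH i j) (fC.1 i).
by rewrite (gE i j k) // comp_lfunDl -!comp_lfunA fC.2.
Qed.

Lemma null_add X Y (f g : forall i, 'Hom(X i, Y i)) :
  null f -> null g -> null (fun i => f i + g i).
Proof.
move=> [h hH fE] [l lH gE]; exists (fun i j => h i j + l i j) => [i j|i j k ej ei].
  exact: hom_add.
by rewrite (fE i j k) // (gE i j k) // comp_lfunDl comp_lfunDr addrACA.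
Qed.

Lemma null_opp X Y (f : forall i, 'Hom(X i, Y i)) : null f -> null (fun i => - f i).
Proof.
move=> [h hH fE]; exists (fun i j => - h i j) => [i j|i j k ej ei].
  exact: hom_opp.
by rewrite (fE i j k) // comp_lfunNl comp_lfunNr opprD.
Qed.

Lemma null_ext X Y (f g : forall i, 'Hom(X i, Y i)) :
  (forall i, f i = g i) -> null f -> null g.
Proof. by move=> e [h hH fE]; exists h => // i j k ej ei; rewrite -e; apply: fE. Qed.

Lemma null_sub X Y (f g : forall i, 'Hom(X i, Y i)) :
  null (fun i => f i - g i) -> null g -> null f.
Proof.
by move=> fg g0; apply: null_ext (null_add fg g0) => i; rewrite subrK.
Qed.

Lemma null_subC X Y (f g : forall i, 'Hom(X i, Y i)) :
  null (fun i => f i - g i) -> null (fun i => g i - f i).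
Proof. by move=> /null_opp; apply: null_ext => i; rewrite opprB. Qed.

Lemma null_subr X Y (f g : forall i, 'Hom(X i, Y i)) :
  null (fun i => f i - g i) -> null f -> null g.
Proof. by move=> /null_subC; apply: null_sub. Qed.

Lemma quasi_isoP X Y (f : chain_map X Y) : quasi_iso f <-> qis f.
Proof.
split=> [qf|[qi qs] i].
  split=> i j k ej ei.
    have [sub _] := qf i.
    subst j; have ek : k = i - 1 by rewrite ei addrK.
    subst k => x y dx fx; have : x \in boundaries X i.
      apply: (subvP sub); rewrite memv_cap memv_ker dx eqxx -memv_preim fx.
      exact: memv_img (memvf _).
    by case/memv_imgP => z _ ->; exists z.
  have [_ sub] := qf i.
  subst j; have ek : k = i - 1 by rewrite ei addrK.
  subst k => y dy; have : y \in cycles Y i by rewrite memv_ker dy.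
  move/(subvP sub); case/memv_addP => u /memv_imgP[x xC ->] [v /memv_imgP[z _ ->] ->].
  by exists x, z; split=> //; apply/eqP; rewrite -memv_ker.
have ei : i = i - 1 + 1 by rewrite subrK.
split; apply/subvP => x.
  rewrite memv_cap memv_ker => /andP[/eqP dx]; rewrite -memv_preim.
  case/memv_imgP => y _ fx; have [z ->] := qi _ _ _ erefl ei _ _ dx fx.
  exact: memv_img (memvf _).
rewrite memv_ker => /eqP dx; have [u [z [du ->]]] := qs _ _ _ erefl ei _ dx.
by apply: memv_add; apply: memv_img; rewrite ?memvf // memv_ker du.
Qed.

Lemma acyclicP X i : acyclic_at X i <-> acyc X i.
Proof.
split=> [/subvP sub j k -> ei x dx|aX].
  have ek : k = i - 1 by rewrite ei addrK.
  subst k; have : x \in cycles X i by rewrite memv_ker dx.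
  by move/sub/memv_imgP => [y _ ->]; exists y.
apply/subvP => x; rewrite memv_ker => /eqP dx.
have [|y ->] := aX _ (i - 1) erefl _ _ dx; first by rewrite subrK.
exact: memv_img (memvf _).
Qed.

Lemma qis_id X : @qis X X (fun=> \1%VF).
Proof.
split=> i j k ej ei => [x y _|y dy]; first by rewrite id_lfunE => ->; exists y.
by exists y, 0; rewrite id_lfunE linear0 addr0.
Qed.

Lemma qis_comp X Y Z (g : forall i, 'Hom(Y i, Z i)) (f : forall i, 'Hom(X i, Y i)) :
  is_chain f -> is_chain g -> qis g -> qis f -> qis (fun i => g i \o f i)%VF.
Proof.
move=> fC gC [gi gs] [fi fs]; split=> i j k ej ei => [x y dx|y dy].
  rewrite comp_lfunE => gfx; have [|z e] := gi _ _ _ ej ei (f i x) y _ gfx.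
    by rewrite -chainE // dx linear0.
  exact: fi dx e.
have [x [z [dx ->]]] := gs _ _ _ ej ei _ dy.
have [w [u [dw ->]]] := fs _ _ _ ej ei _ dx.
by exists w, (g k u + z); split=> //; rewrite comp_lfunE !linearD /= chainE // addrA.
Qed.

Lemma qis_homotopic X Y (f g : forall i, 'Hom(X i, Y i)) :
  null (fun i => f i - g i) -> qis g -> qis f.
Proof.
move=> [h hH fg] [gi gs].
have fE (i j k : int) x : j = i + 1 -> i = k + 1 -> cdiff X i j x = 0 ->
    f i x = g i x + cdiff Y k i (h i k x).
  move=> ej ei dx; have /lfunP/(_ x) := fg _ _ _ ej ei.
  rewrite !add_lfunE opp_lfunE !comp_lfunE dx linear0 addr0 => <-.
  by rewrite addrC subrK.
split=> i j k ej ei => [x y dx fx|y dy].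
  apply: (gi _ _ _ ej ei x (y - h i k x)) => //.
  by rewrite linearB /= -fx (fE _ _ _ x ej ei) // addrK.
have [x [z [dx ->]]] := gs _ _ _ ej ei _ dy.
exists x, (z - h i k x); split=> //.
by rewrite (fE _ _ _ x ej ei) // linearB /= -addrA [_ + (_ - _)]addrC subrK.
Qed.

Lemma qis_cancel X Y Z (s : forall i, 'Hom(Y i, Z i)) (f : forall i, 'Hom(X i, Y i)) :
  is_chain s -> is_chain f -> qis s -> qis (fun i => s i \o f i)%VF -> qis f.
Proof.
move=> sC fC [si ss] [gi gs]; split=> i j k ej ei => [x y dx fx|y dy].
  by apply: (gi _ _ _ ej ei x (s k y)) => //; rewrite comp_lfunE fx chainE.
have [|x [z [dx]]] := gs _ _ _ ej ei (s i y).
  by rewrite -chainE // dy linear0.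
rewrite comp_lfunE => e.
have [||w ew] := si _ _ _ ej ei (y - f i x) z.
- by rewrite linearB /= dy -chainE // dx linear0 subr0.
- by rewrite linearB /= e addrC addKr.
by exists x, w; split=> //; rewrite -ew addrC subrK.
Qed.

(** ** Lifting along quasi-isomorphisms *)

Definition projcx P : Prop :=
  (forall i, is_projective (P i)) /\
  exists b : int, forall i : int, b <= i -> is_zero (P i).

(** One step of the comparison theorem.  The pair [(u, v)] is a cocycle with
    values in the mapping cone of [s]; exactness of the cone and projectivity of
    [Q] make it a coboundary. *)
Lemma lift_step (Q : lmod A) Y Y' (s : forall i, 'Hom(Y i, Y' i)) (m k l p : int)
    (u : 'Hom(Q, Y l)) (v : 'Hom(Q, Y' k)) :
  is_projective Q -> is_chain s -> qis s ->
  k = m + 1 -> l = k + 1 -> p = l + 1 -> is_hom u -> is_hom v ->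
  (cdiff Y l p \o u = 0)%VF -> (cdiff Y' k l \o v = s l \o u)%VF ->
  exists (a : 'Hom(Q, Y k)) (b : 'Hom(Q, Y' m)),
    [/\ is_hom a, is_hom b, (cdiff Y k l \o a = u)%VF &
        v = ((s k \o a) + (cdiff Y' m k \o b))%VF].
Proof.
move=> projQ sC [si ss] ek el ep uH vH du dv.
pose N := dsum (Y k) (Y' m).
pose q : 'Hom(N, dsum (Y l) (Y' k)) := dpair (cdiff Y k l \o dfst (Y k) (Y' m))%VF
  ((s k \o dfst (Y k) (Y' m)) + (cdiff Y' m k \o dsnd (Y k) (Y' m)))%VF.
have qH : is_hom q.
  apply: dpair_hom; first by apply: hom_comp; [apply: cdiff_hom | apply: dfst_hom].
  apply: hom_add; apply: hom_comp.
  - exact: sC.1.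
  - exact: dfst_hom.
  - exact: cdiff_hom.
  - exact: dsnd_hom.
have qE x y : q ((x, y) : N) = (cdiff Y k l x, s k x + cdiff Y' m k y).
  by rewrite dpairE add_lfunE !comp_lfunE dfstE dsndE.
have [x|g gH e] := projective_lift projQ qH (dpair_hom uH vH).
  have /lfunP/(_ x) := du; have /lfunP/(_ x) := dv.
  rewrite !comp_lfunE zero_lfunE => dvx dux.
  have [a0 ea0] := si _ _ _ ep el _ _ dux (esym dvx).
  have dw : cdiff Y' k l (v x - s k a0) = 0.
    by rewrite linearB /= dvx -chainE // ea0 subrr.
  have [z [b [dz eb]]] := ss _ _ _ el ek _ dw.
  exists ((a0 + z, b) : N); rewrite qE dpairE linearD /= dz addr0 -ea0.
  by rewrite linearD /= -addrA -eb [s k a0 + _]addrC subrK.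
exists (dfst (Y k) (Y' m) \o g)%VF, (dsnd (Y k) (Y' m) \o g)%VF.
have eE x : (u x, v x) = q (g x).
  by have /lfunP/(_ x) := e; rewrite dpairE comp_lfunE.
split.
- by apply: hom_comp => //; apply: dfst_hom.
- by apply: hom_comp => //; apply: dsnd_hom.
- apply/lfunP => x; rewrite !comp_lfunE dfstE.
  by have := eE x; case: (g x) => gx1 gx2; rewrite qE => -[].
- apply/lfunP => x; rewrite add_lfunE !comp_lfunE dfstE dsndE.
  by have := eE x; case: (g x) => gx1 gx2; rewrite qE => -[].
Qed.

(** The comparison theorem, uniqueness: a homotopy from [s f] to zero makes
    [f] a cocycle with values in the cone of [s], and [lift_step] kills it degree
    by degree, from the top down. *)
Lemma lift_null P Y Y' (s : forall i, 'Hom(Y i, Y' i)) (f : forall i, 'Hom(P i, Y i)) :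
  projcx P -> is_chain s -> qis s -> is_chain f ->
  null (fun i => s i \o f i)%VF -> null f.
Proof.
move=> [projP [b0 P0]] sC sQ fC [th thH sf].
pose T i := ((forall k, 'Hom(P i, Y k)) * (forall k, 'Hom(P i, Y' k)))%type.
pose Inv j (x : T j) := [/\ forall k, is_hom (x.1 k), forall k, is_hom (x.2 k) &
  forall i k : int, j = i + 1 -> i = k + 1 ->
  ((cdiff Y i j \o x.1 i) \o cdiff P i j = f j \o cdiff P i j)%VF /\
  ((cdiff Y' k i \o x.2 k) \o cdiff P i j
     = (th j i - (s i \o x.1 i)) \o cdiff P i j)%VF].
pose R i j (x : T j) (y : T i) := (forall k, is_hom (y.1 k)) /\ forall k m : int,
  j = i + 1 -> i = k + 1 -> k = m + 1 ->
  (f i = (cdiff Y k i \o y.1 k) + (x.1 i \o cdiff P i j))%VF /\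
  (th i k + (x.2 k \o cdiff P i j) = (s k \o y.1 k) + (cdiff Y' m k \o y.2 m))%VF.
pose z i : T i := (fun=> 0, fun=> 0).
have [||i j x ej [aH bH invx]|t tP] := @descending_family T Inv R b0 z.
- move=> j le_bj; split=> [k|k|i k _ _]; try exact: zero_is_hom.
  by rewrite [cdiff P i j](hom_zero_cod _ (P0 j le_bj)) !comp_lfun0r.
- move=> i j le_bi; split=> [k|k m ej ei ek]; first exact: zero_is_hom.
  by split; rewrite [LHS](hom_zero_dom _ (P0 i le_bi)) [RHS](hom_zero_dom _ (P0 i le_bi)).
- case: x aH bH invx => a b /= aH bH invx.
  pose k := i - 1; pose m := k - 1; pose l := j + 1.
  have ei : i = k + 1 by rewrite /k subrK.
  have ek : k = m + 1 by rewrite /m subrK.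
  have [inva invb] := invx _ _ ej ei.
  pose u := f i - (a i \o cdiff P i j)%VF.
  pose v := th i k + (b k \o cdiff P i j)%VF.
  have uH : is_hom u.
    by apply: hom_sub; [exact: fC.1 | apply: hom_comp => //; apply: cdiff_hom].
  have vH : is_hom v.
    by apply: hom_add => //; apply: hom_comp => //; apply: cdiff_hom.
  have [||a' [b' [a'H b'H ea eb]]] :=
    lift_step (projP i) sC sQ ek ei ej uH vH.
  + by rewrite comp_lfunDr comp_lfunNr comp_lfunA inva -fC.2 subrr.
  + rewrite comp_lfunDr comp_lfunA invb /u comp_lfunDr comp_lfunNr (sf _ _ _ ej ei).
    by rewrite comp_lfunDl comp_lfunNl comp_lfunA addrA.
  have [?|a2 [a2k a2H]] := extend_point (T := fun k => 'Hom(P i, Y k))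
    (Q := fun k f => is_hom f) (z := fun=> 0) a'H; first exact: zero_is_hom.
  have [?|b2 [b2m b2H]] := extend_point (T := fun k => 'Hom(P i, Y' k))
    (Q := fun k f => is_hom f) (z := fun=> 0) b'H; first exact: zero_is_hom.
  exists (a2, b2); split; last first.
    split=> // k' m' _ ei' ek'.
    have ekk : k' = k by apply: (addIr 1); rewrite -ei' -ei.
    have emm : m' = m by apply: (addIr 1); rewrite -ek' -ek.
    by rewrite ekk emm /= a2k b2m ea -eb /u subrK.
  split=> // i0 k0 ei0 ek0.
  have ek' : i0 = k by apply: (addIr 1); rewrite -ei0 -ei.
  have em : k0 = m by apply: (addIr 1); rewrite -ek0 ek' -ek.
  rewrite ek' em /= a2k b2m ea; split.
    by rewrite /u comp_lfunDl comp_lfunNl -comp_lfunA cdiff_comp comp_lfun0r subr0.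
  have -> : (cdiff Y' m k \o b' = v - (s k \o a'))%VF by rewrite eb addrC addKr.
  by rewrite /v addrAC [LHS]comp_lfunDl -(comp_lfunA (b k)) cdiff_comp comp_lfun0r addr0.
- exists (fun i j => (t i).1 j) => [i k|i j k ej ei].
    by have [tH _] := tP i _ erefl; apply: tH.
  have [_ /(_ k (k - 1) ej ei)[|fE _]] := tP i j ej; first by rewrite subrK.
  exact: fE.
Qed.

(** The comparison theorem, existence, by the same descent. *)
Lemma lift_map P Y Y' (s : forall i, 'Hom(Y i, Y' i)) (g : forall i, 'Hom(P i, Y' i)) :
  projcx P -> is_chain s -> qis s -> is_chain g ->
  exists2 f : forall i, 'Hom(P i, Y i), is_chain f &
    null (fun i => (s i \o f i)%VF - g i).
Proof.
move=> [projP [b0 P0]] sC sQ gC.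
pose T i := ('Hom(P i, Y i) * (forall k, 'Hom(P i, Y' k)))%type.
pose Inv j (x : T j) := [/\ is_hom x.1, forall k, is_hom (x.2 k) &
  forall i l : int, j = i + 1 -> l = j + 1 ->
  ((cdiff Y j l \o x.1) \o cdiff P i j = 0)%VF /\
  ((cdiff Y' i j \o x.2 i) \o cdiff P i j
     = ((s j \o x.1) - g j) \o cdiff P i j)%VF].
pose R i j (x : T j) (y : T i) := [/\ is_hom y.1, forall k, is_hom (y.2 k) &
  forall k : int, j = i + 1 -> i = k + 1 ->
  (cdiff Y i j \o y.1 = x.1 \o cdiff P i j)%VF /\
  ((s i \o y.1) - g i = (cdiff Y' k i \o y.2 k) + (x.2 i \o cdiff P i j))%VF].
pose z i : T i := (0, fun=> 0).
have [||i j x ej [aH bH invx]|t tP] := @descending_family T Inv R b0 z.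
- move=> j le_bj; split=> [|k|i l _ _]; try exact: zero_is_hom.
  by rewrite [cdiff P i j](hom_zero_cod _ (P0 j le_bj)) !comp_lfun0r.
- move=> i j le_bi; split=> [|k|k ej ei]; try exact: zero_is_hom.
  by split; rewrite [LHS](hom_zero_dom _ (P0 i le_bi)) [RHS](hom_zero_dom _ (P0 i le_bi)).
- case: x aH bH invx => a b /= aH bH invx.
  pose k := i - 1; pose l := j + 1.
  have ei : i = k + 1 by rewrite /k subrK.
  have [inva invb] := invx _ _ ej (erefl l).
  pose u := (a \o cdiff P i j)%VF.
  pose v := (g i + (b i \o cdiff P i j))%VF.
  have uH : is_hom u by apply: hom_comp => //; apply: cdiff_hom.
  have vH : is_hom v.
    by apply: hom_add; [exact: gC.1 | apply: hom_comp => //; apply: cdiff_hom].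
  have [||a' [b' [a'H b'H ea eb]]] :=
    lift_step (projP i) sC sQ ei ej (erefl l) uH vH.
  + by rewrite /u comp_lfunA.
  + rewrite comp_lfunDr comp_lfunA invb /u comp_lfunDl comp_lfunNl gC.2.
    by rewrite addrC subrK comp_lfunA.
  have [?|b2 [b2m b2H]] := extend_point (T := fun k => 'Hom(P i, Y' k))
    (Q := fun k f => is_hom f) (z := fun=> 0) (hom_opp b'H).
    exact: zero_is_hom.
  have esg : ((s i \o a') - g i
      = (cdiff Y' k i \o b2 k) + (b i \o cdiff P i j))%VF.
    have -> : (s i \o a' = v - (cdiff Y' k i \o b'))%VF by rewrite eb addrK.
    by rewrite b2m comp_lfunNr addrAC /v [g i + _]addrC addrK addrC.
  exists (a', b2); split; last first.
    split=> // k' _ ei'; have -> : k' = k by apply: (addIr 1); rewrite -ei' -ei.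
    by [].
  split=> // i0 l0 ei0 el0; have ek' : i0 = k by apply: (addIr 1); rewrite -ei0 -ei.
  have -> : l0 = j by rewrite el0 ej.
  rewrite ek' /= esg ea /u -comp_lfunA cdiff_comp comp_lfun0r; split=> //.
  by rewrite [RHS]comp_lfunDl -(comp_lfunA (b i)) cdiff_comp comp_lfun0r addr0.
exists (fun i => (t i).1).
  apply: chainI => [i|i j ej]; first by case: (tP i _ erefl).
  have [_ _ /(_ (i - 1) ej)] := tP i j ej.
  by case=> [|-> _]; first by rewrite subrK.
exists (fun i j => (t i).2 j) => [i k|i j k ej ei].
  by case: (tP i _ erefl) => _ tH _; apply: tH.
by have [_ _ /(_ k ej ei)[_ ->]] := tP i j ej.
Qed.

End Homotopy.

(** * Vanishing of morphisms in the homotopy and derived categories *)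

Section Vanishing.
Context {K : fieldType} {A : falgType K}.
Implicit Types X Y Z P Q : complex A.

Definition Kvanish X Y : Prop :=
  forall f : forall i, 'Hom(X i, Y i), is_chain f -> null f.

Definition resolution P X : Prop :=
  projcx P /\ exists2 f : forall i, 'Hom(P i, X i), is_chain f & qis f.

Definition resolvable X : Prop := exists P, resolution P X.

(** Morphisms in the derived category are computed on projective resolutions.
    Quantifying over all of them leaves existence as a separate hypothesis. *)
Definition Dvanish X Y : Prop := forall P, resolution P X -> Kvanish P Y.

Definition qiso X Y : Prop :=
  exists (Z : complex A) (f : forall i, 'Hom(Z i, X i)) (g : forall i, 'Hom(Z i, Y i)),
    [/\ is_chain f, is_chain g, qis f & qis g].

Lemma Db_iso_qiso (X Y : Db A) : Db_iso X Y -> qiso X Y.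
Proof.
case=> Z [f [g [/quasi_isoP qf /quasi_isoP qg]]].
by exists Z, f, g; split=> //; apply: cmap_chain.
Qed.

Lemma qiso_sym X Y : qiso X Y -> qiso Y X.
Proof. by case=> Z [f [g [? ? ? ?]]]; exists Z, g, f. Qed.

Lemma qis_qiso X Y (f : forall i, 'Hom(X i, Y i)) : is_chain f -> qis f -> qiso X Y.
Proof.
move=> fC fQ; exists X, (fun=> \1%VF), f.
by split=> //; [apply: chain_id | apply: qis_id].
Qed.

Lemma Db_iso_refl (X : Db A) : Db_iso X X.
Proof.
have idC := chain_id X; exists X, (chain_pack idC), (chain_pack idC).
by split; apply/quasi_isoP; apply: qis_id.
Qed.

Lemma Kvanish_targetE P Y Y' (s : forall i, 'Hom(Y i, Y' i)) :
  projcx P -> is_chain s -> qis s -> Kvanish P Y <-> Kvanish P Y'.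
Proof.
move=> projP sC sQ; split=> v f fC.
  have [g gC sgf] := lift_map projP sC sQ fC.
  exact: null_subr sgf (null_compl sC (v g gC)).
by apply: (lift_null projP sC sQ fC); apply: v; apply: chain_comp.
Qed.

Lemma Kvanish_target P Y Y' : projcx P -> qiso Y Y' -> Kvanish P Y -> Kvanish P Y'.
Proof.
move=> projP [Z [f [g [fC gC fQ gQ]]]] v.
by rewrite -(Kvanish_targetE projP gC gQ) (Kvanish_targetE projP fC fQ).
Qed.

(** A quasi-isomorphism between complexes of projectives is a homotopy
    equivalence. *)
Lemma homotopy_inverse P Q (r : forall i, 'Hom(P i, Q i)) :
  projcx P -> projcx Q -> is_chain r -> qis r ->
  exists2 t : forall i, 'Hom(Q i, P i), is_chain t &
    null (fun i => (r i \o t i)%VF - \1%VF) /\ null (fun i => (t i \o r i)%VF - \1%VF).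
Proof.
move=> projP projQ rC rQ; have [t tC rt] := lift_map projQ rC rQ (chain_id Q).
exists t => //; split=> //.
apply: (lift_null projP rC rQ).
  by apply: chain_sub; [apply: chain_comp | apply: chain_id].
apply: null_ext (null_compr rC rt) => i.
by rewrite comp_lfunDl comp_lfunDr comp_lfunNl comp_lfunNr comp_lfun1l comp_lfun1r comp_lfunA.
Qed.

Lemma Kvanish_source P Q (r : forall i, 'Hom(P i, Q i)) Y :
  projcx P -> projcx Q -> is_chain r -> qis r -> Kvanish Q Y -> Kvanish P Y.
Proof.
move=> projP projQ rC rQ v f fC.
have [t tC [_ tr]] := homotopy_inverse projP projQ rC rQ.
apply: (@null_subr _ _ _ _ (fun i => (f i \o t i) \o r i)%VF).
  apply: null_ext (null_compl fC tr) => i.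
  by rewrite comp_lfunDr comp_lfunNr comp_lfun1r comp_lfunA.
by apply: null_compr => //; apply: v; apply: chain_comp.
Qed.

Lemma resolution_qiso P X X' : qiso X X' -> resolution P X -> resolution P X'.
Proof.
move=> [Z [f [g [fC gC fQ gQ]]]] [projP [p pC pQ]]; split=> //.
have [q qC fqp] := lift_map projP fC fQ pC.
have qQ : qis q.
  apply: (qis_cancel fC qC fQ); exact: qis_homotopic fqp pQ.
by exists (fun i => g i \o q i)%VF; [apply: chain_comp | apply: qis_comp].
Qed.

Lemma resolvable_qiso X X' : qiso X X' -> resolvable X -> resolvable X'.
Proof. by move=> e [P PX]; exists P; apply: resolution_qiso PX. Qed.

Lemma resolution_self P : projcx P -> resolution P P.
Proof.
by move=> projP; split=> //; exists (fun=> \1%VF); [apply: chain_id | apply: qis_id].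
Qed.

Lemma Dvanish_resolution P X Y : resolution P X -> Kvanish P Y -> Dvanish X Y.
Proof.
move=> [projP [p pC pQ]] v Q [projQ [q qC qQ]].
have [r rC prq] := lift_map projQ pC pQ qC.
have rQ : qis r by apply: (qis_cancel pC rC pQ); exact: qis_homotopic prq qQ.
exact: Kvanish_source rC rQ v.
Qed.

Lemma Dvanish_target X Y Y' : qiso Y Y' -> Dvanish X Y -> Dvanish X Y'.
Proof. by move=> e v P PX; apply: (Kvanish_target PX.1 e); apply: v. Qed.

Lemma Dvanish_source X X' Y : qiso X X' -> Dvanish X Y -> Dvanish X' Y.
Proof. by move=> e v P PX; apply/v/(resolution_qiso _ PX)/qiso_sym. Qed.

(** ** Shifts *)

Lemma qis_bij X Y (f : forall i, 'Hom(X i, Y i)) : is_chain f ->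
  (forall i, injective (f i)) -> (forall i y, exists x, f i x = y) -> qis f.
Proof.
move=> fC fI fS; split=> i j k ej ei => [x y dx fx|y dy].
  by have [z ez] := fS k y; exists z; apply: fI; rewrite fx chainE // ez.
have [x ex] := fS i y; exists x, 0; rewrite linear0 addr0 ex; split=> //.
by apply: fI; rewrite chainE // ex dy linear0.
Qed.

Definition degree_cast X (i j : int) (e : i = j) : 'Hom(X i, X j) :=
  eq_rect i (fun j => 'Hom(X i, X j)) \1%VF j e.

Lemma degree_cast_bij X i j (e : i = j) : bijective (degree_cast X e).
Proof.
by case: j / e; exists id => x; rewrite /degree_cast /= id_lfunE.
Qed.

Lemma degree_cast_hom X i j (e : i = j) : is_hom (degree_cast X e).
Proof. by case: j / e; apply: hom_id. Qed.

Lemma degree_cast_diff X i i' j j' (e : i = i') (e' : j = j') :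
  (degree_cast X e' \o cdiff X i j = cdiff X i' j' \o degree_cast X e)%VF.
Proof. by case: i' / e; case: j' / e'; rewrite comp_lfun1l comp_lfun1r. Qed.

Lemma shift_sign (a b : int) : (-1) ^+ `|a + b| = (-1) ^+ `|b| * (-1) ^+ `|a| :> K.
Proof.
rewrite -exprD -signr_odd -[RHS]signr_odd; congr (_ ^+ nat_of_bool _); lia.
Qed.

(** Iterated shifts agree with single ones only up to transport along equalities
    of degrees, so the comparison is a chain isomorphism. *)
Lemma shift_shift_map X (a b c : int) : c = a + b ->
  exists2 f : forall i : int, 'Hom(X (i + b + a), X (i + c)),
    @is_chain _ _ (shift_complex (shift_complex X a) b) (shift_complex X c) f &
    @qis _ _ (shift_complex (shift_complex X a) b) (shift_complex X c) f.
Proof.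
move=> ec; have e i : i + b + a = i + c by rewrite ec -addrA [b + a]addrC.
pose f i := degree_cast X (e i).
have C : @is_chain _ _ (shift_complex (shift_complex X a) b) (shift_complex X c) f.
  split=> [i|i j]; first exact: (@degree_cast_hom X _ _ (e i)).
  by rewrite /= scalerA -shift_sign -ec -comp_lfunZl -comp_lfunZr degree_cast_diff.
exists f => //; apply: (qis_bij C) => [i x y|i y].
  exact: (bij_inj (degree_cast_bij X (e i))).
by have [g _ gK] := degree_cast_bij X (e i); exists (g y); rewrite /f gK.
Qed.

Lemma shift_shift X (a b c : int) : c = a + b ->
  qiso (shift_complex (shift_complex X a) b) (shift_complex X c).
Proof. by case/(shift_shift_map X) => f fC; apply: qis_qiso fC. Qed.

Lemma shift0_map X : exists2 f : forall i : int, 'Hom(X (i + 0), X i),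
  @is_chain _ _ (shift_complex X 0) X f & @qis _ _ (shift_complex X 0) X f.
Proof.
pose f i := degree_cast X (addr0 i).
have C : @is_chain _ _ (shift_complex X 0) X f.
  split=> [i|i j]; first exact: (@degree_cast_hom X _ _ (addr0 i)).
  by rewrite /= expr0 scale1r; apply: degree_cast_diff.
exists f => //; apply: (qis_bij C) => [i x y|i y].
  exact: (bij_inj (degree_cast_bij X (addr0 i))).
by have [g _ gK] := degree_cast_bij X (addr0 i); exists (g y); rewrite /f gK.
Qed.

Lemma shift0 X : qiso (shift_complex X 0) X.
Proof. by case: (shift0_map X) => f fC; apply: qis_qiso fC. Qed.

Lemma shiftK X (a b : int) : a + b = 0 ->
  qiso (shift_complex (shift_complex X a) b) X.
Proof.
move=> /esym/(shift_shift_map X)[f fC fQ]; have [g gC gQ] := shift0_map X.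
exact: qis_qiso (chain_comp gC fC) (qis_comp fC gC gQ fQ).
Qed.

Lemma chain_shift X Y (f : forall i, 'Hom(X i, Y i)) k : is_chain f ->
  @is_chain _ _ (shift_complex X k) (shift_complex Y k) (fun i => f (i + k)).
Proof.
move=> fC; split=> [i|i j]; first exact: fC.1.
by rewrite /= -comp_lfunZl -comp_lfunZr fC.2.
Qed.

Lemma qis_shift X Y (f : forall i, 'Hom(X i, Y i)) k : qis f ->
  @qis _ _ (shift_complex X k) (shift_complex Y k) (fun i => f (i + k)).
Proof.
move=> [fi fs]; split=> i j l ej ei => [x y|y] /=.
  rewrite !scale_lfunE => /eqP; rewrite scaler_eq0 signr_eq0 /= => /eqP dx fx.
  have [||||z ->] := fi (i + k) (j + k) (l + k) _ _ x ((-1) ^+ `|k| *: y) => //.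
  - by rewrite ej addrAC.
  - by rewrite ei addrAC.
  - by rewrite linearZ.
  by exists ((-1) ^+ `|k| *: z); rewrite /= scale_lfunE linearZ /= scalerA -expr2 sqrr_sign scale1r.
rewrite scale_lfunE => /eqP; rewrite scaler_eq0 signr_eq0 /= => /eqP dy.
have [|||x [z [dx ->]]] := fs (i + k) (j + k) (l + k) _ _ y => //.
- by rewrite ej addrAC.
- by rewrite ei addrAC.
exists x, ((-1) ^+ `|k| *: z); rewrite !scale_lfunE dx scaler0; split=> //.
by rewrite linearZ /= scalerA -expr2 sqrr_sign scale1r.
Qed.

Lemma projcx_shift P k : projcx P -> projcx (shift_complex P k).
Proof.
move=> [projP [b P0]]; split=> [i|]; first exact: projP.
by exists (b - k) => i le_bi; apply: P0; rewrite -lerBlDr.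
Qed.

Lemma resolution_shift P X k :
  resolution P X -> resolution (shift_complex P k) (shift_complex X k).
Proof.
move=> [projP [f fC fQ]]; split; first exact: projcx_shift.
by exists (fun i => f (i + k)); [apply: chain_shift | apply: qis_shift].
Qed.

Lemma resolvable_shift X k : resolvable X -> resolvable (shift_complex X k).
Proof. by move=> [P PX]; exists (shift_complex P k); apply: resolution_shift. Qed.

Lemma resolvable_unshift X k : resolvable (shift_complex X k) -> resolvable X.
Proof.
move=> /(resolvable_shift (- k)); apply: resolvable_qiso.
by apply: shiftK; rewrite subrr.
Qed.

(** Reindexing a family by [i |-> i - k] is again an instance of extending along
    an injection. *)
Lemma Kvanish_unshift X Y k :
  Kvanish (shift_complex X k) (shift_complex Y k) -> Kvanish X Y.
Proof.
move=> v f fC; have [h hH fE] := v _ (chain_shift k fC).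
pose phi (p : int * int) := (p.1 + k, p.2 + k).
have phi_inj : injective phi by move=> [a b] [a' b'] [/addIr -> /addIr ->].
have [h' [h'E _]] := @extend_family _ (int * int)%type phi (fun p => 'Hom(X p.1, Y p.2))
  (fun p => (-1) ^+ `|k| *: h p.1 p.2) (fun=> 0) phi_inj.
have h'E' i j : h' (i + k, j + k) = (-1) ^+ `|k| *: h i j := h'E (i, j).
exists (fun i j => h' (i, j)) => [i j|i j l ej ei].
  have [i' ->] : exists i', i = i' + k by exists (i - k); rewrite subrK.
  have [j' ->] : exists j', j = j' + k by exists (j - k); rewrite subrK.
  by rewrite h'E'; apply/hom_scale/hH.
have [i' ei'] : exists i', i = i' + k by exists (i - k); rewrite subrK.
have [j' ej'] : exists i', j = i' + k by exists (j - k); rewrite subrK.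
have [l' el'] : exists i', l = i' + k by exists (l - k); rewrite subrK.
have ej0 : j' = i' + 1 by apply: (addIr k); rewrite -ej' ej ei' addrAC.
have ei0 : i' = l' + 1 by apply: (addIr k); rewrite -ei' ei el' addrAC.
clear ej ei; subst i j l; rewrite !h'E' (fE i' j' l') //=.
by rewrite -!comp_lfunZl -!comp_lfunZr.
Qed.

Lemma Dvanish_shift X Y k :
  Dvanish X Y -> Dvanish (shift_complex X k) (shift_complex Y k).
Proof.
move=> v P PX; apply: (@Kvanish_unshift _ _ (- k)).
have PX' : resolution (shift_complex P (- k)) X.
  apply: resolution_qiso (resolution_shift (- k) PX).
  by apply: shiftK; rewrite subrr.
apply: (Kvanish_target PX'.1 _ (v _ PX')).
by apply/qiso_sym/shiftK; rewrite subrr.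
Qed.

(** [Hom(X, Y[j]) = 0] in the derived category. *)
Definition Dhom0 X Y (j : int) : Prop := Dvanish X (shift_complex Y j).

Lemma Dhom0_source X X' Y j : qiso X X' -> Dhom0 X Y j -> Dhom0 X' Y j.
Proof. exact: Dvanish_source. Qed.

Lemma qiso_shift X Y k : qiso X Y -> qiso (shift_complex X k) (shift_complex Y k).
Proof.
move=> [Z [f [g [fC gC fQ gQ]]]].
exists (shift_complex Z k), (fun i => f (i + k)), (fun i => g (i + k)).
by split; [apply: chain_shift | apply: chain_shift | apply: qis_shift | apply: qis_shift].
Qed.

Lemma Dhom0_target X Y Y' j : qiso Y Y' -> Dhom0 X Y j -> Dhom0 X Y' j.
Proof. by move=> /(qiso_shift j); apply: Dvanish_target. Qed.

Lemma Dhom0_shift_source X Y (a j k : int) : j = k + a ->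
  Dhom0 (shift_complex X a) Y j <-> Dhom0 X Y k.
Proof.
move=> ej; split=> [/(@Dvanish_shift _ _ (- a)) v|/(@Dvanish_shift _ _ a) v].
  apply: Dvanish_source (shiftK _ (subrr a)) _.
  by apply: Dvanish_target v; apply: shift_shift; rewrite ej addrK.
by apply: Dvanish_target v; apply: shift_shift.
Qed.

End Vanishing.

(** * Linear duality for finite families of vector spaces *)

Import VectorInternalTheory.

Section Families.
Context {K : fieldType}.

Lemma functional_factor (V W : vectType K) (f : 'Hom(V, W)) (phi : 'Hom(V, K^o)) :
  (forall v, f v = 0 -> phi v = 0) -> exists psi : 'Hom(W, K^o), phi = (psi \o f)%VF.
Proof.
move=> kerf; exists (phi \o f^-1)%VF; apply/lfunP => v.
rewrite !comp_lfunE; apply/eqP; rewrite -subr_eq0 -linearB; apply/eqP.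
by apply: kerf; rewrite linearB /= limg_lfunVK ?subrr // memv_img ?memvf.
Qed.

Section Product.
Variables (n : nat) (V : 'I_n -> vectType K).

Definition family_pack (c : forall k, V k) : 'rV[K]_(\sum_k dim (V k)) :=
  \mxrow_k v2r (c k).

Definition family_get (w : 'rV[K]_(\sum_k dim (V k))) k : V k := r2v (submxrow w k).

Lemma family_packK c k : family_get (family_pack c) k = c k.
Proof. by rewrite /family_get /family_pack mxrowK v2rK. Qed.

Lemma family_getK w : family_pack (family_get w) = w.
Proof.
rewrite -[RHS]submxrowK; apply: eq_mxrow => k.
by rewrite r2vK.
Qed.

Lemma family_get_linear k : linear (family_get^~ k).
Proof.
move=> a u v; rewrite /family_get -linearP; congr r2v.
by apply/rowP => i; rewrite !mxE.
Qed.

Lemma family_pack_linear a c c' c'' : (forall k, c'' k = a *: c k + c' k) ->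
  family_pack c'' = a *: family_pack c + family_pack c'.
Proof.
move=> cE; rewrite -[RHS]family_getK; apply: eq_mxrow => k.
by rewrite family_get_linear !family_packK cE.
Qed.

Lemma functional_family (psi : 'rV[K]_(\sum_k dim (V k)) -> K) :
  (forall a u v, psi (a *: u + v) = a * psi u + psi v) ->
  exists psis : forall k, 'Hom(V k, K^o), forall w,
    psi w = \sum_k psis k (family_get w k).
Proof.
move=> psiL; pose f (w : 'rV[K]_(\sum_k dim (V k))) : 'rV[K]_1 := (psi w)%:M.
have fL : linear f by move=> a u v; rewrite /f psiL raddfD /= scale_scalar_mx.
pose F : {linear 'rV[K]_(\sum_k dim (V k)) -> 'rV[K]_1} := HB.pack f
  (GRing.isSemilinear.Build K _ _ _ f (GRing.semilinear_linear fL)).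
pose u := lin1_mx F.
have gL k : linear (fun v : V k => ((v2r v *m submxcol u k) 0 0 : K^o)).
  by move=> a v w; rewrite linearP mulmxDl -scalemxAl !mxE.
exists (fun k => linfun (fun v : V k => ((v2r v *m submxcol u k) 0 0 : K^o))) => w.
transitivity ((w *m u) 0 0).
  by rewrite mul_rV_lin1 /= /f !mxE eqxx mulr1n.
rewrite -[w in LHS]submxrowK -[u in LHS]submxcolK mul_mxrow_mxcol summxE.
by apply: eq_bigr => k _; rewrite linfun_linearE // /family_get r2vK.
Qed.

End Product.

(** The Fredholm alternative for a finite system of equations; packing families
    reduces it to a functional vanishing on the kernel of one linear map. *)
Lemma family_functional_factor (n p : nat) (V : 'I_n -> vectType K)
    (W : 'I_p -> vectType K) (D : forall l, (forall k, V k) -> W l)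
    (L : (forall k, V k) -> K) :
  (forall a c c' c'', (forall k, c'' k = a *: c k + c' k) ->
     L c'' = a * L c + L c' /\ forall l, D l c'' = a *: D l c + D l c') ->
  (forall c, (forall l, D l c = 0) -> L c = 0) ->
  exists psi : forall l, 'Hom(W l, K^o), forall c, L c = \sum_l psi l (D l c).
Proof.
move=> lin ker.
have getP a u v k : @family_get n V (a *: u + v) k
    = a *: family_get u k + family_get v k by exact: family_get_linear.
pose f w := family_pack (fun l => D l (@family_get n V w)).
have fL : linear f.
  by move=> a u v; apply: family_pack_linear; have [] := lin a _ _ _ (getP a u v).
have LL : linear (fun w => L (@family_get n V w) : K^o).
  by move=> a u v; have [-> _] := lin a _ _ _ (getP a u v).
have [w|psi epsi] := @functional_factor _ _ (linfun f)
    (linfun (fun w => L (@family_get n V w) : K^o)).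
  rewrite !linfun_linearE // => fw; apply: ker => l.
  rewrite -[LHS](@family_packK _ W (fun l => D l _) l) -/(f w) fw.
  by rewrite /family_get -(linear0 (@r2v _ (W l))); congr r2v; apply/rowP => i; rewrite !mxE.
have [a u v|psis psisE] := @functional_family _ W psi; first by rewrite linearP.
exists psis => c; have /lfunP/(_ (family_pack c)) := epsi.
rewrite comp_lfunE !linfun_linearE // psisE.
have cE k : family_get (family_pack c) k = 0 *: family_get (family_pack c) k + c k.
  by rewrite scale0r add0r family_packK.
have [eL eD] := lin 0 _ _ _ cE.
rewrite eL mul0r add0r => ->; apply: eq_bigr => l _.
by rewrite family_packK eD scale0r add0r.
Qed.

End Families.

(** * Duality of bigraded Hom spaces *)

(** The spaces [Hom(X i, Y j)] with post- and precomposition by differentials;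
    only these operations matter for homotopy vanishing, and they are symmetric
    under duality. *)
Record bigraded (K : fieldType) := Bigraded {
  bobj :> int -> int -> vectType K;
  bpost : forall i j j', 'Hom(bobj i j, bobj i j');
  bpre : forall i' i j, 'Hom(bobj i j, bobj i' j);
  bpost_shape : forall i j j', j' != j + 1 -> bpost i j j' = 0;
  bpre_shape : forall i' i j, i != i' + 1 -> bpre i' i j = 0 }.

Arguments bpost {K} b {i} j j'.
Arguments bpre {K} b i' i {j}.

(** Exactness in total degree zero, that is, every chain map is null-homotopic. *)
Definition bexact (K : fieldType) (C : bigraded K) : Prop :=
  forall f : forall i, C i i,
    (forall i j, bpost C i j (f i) = bpre C i j (f j)) ->
  exists h : forall i j, C i j, forall i j k : int, j = i + 1 -> i = k + 1 ->
    f i = bpost C k i (h i k) + bpre C i j (h j i).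

Lemma alternating_telescope (R : pzRingType) (v : nat -> R) m :
  \sum_(k < m) (-1) ^+ k * (v k + v k.+1) = v 0%N - (-1) ^+ m * v m.
Proof.
elim: m => [|m IHm]; first by rewrite big_ord0 expr0 mul1r subrr.
by rewrite big_ord_recr /= IHm exprS mulN1r mulNr opprK mulrDr addrA subrK.
Qed.

Section Duality.
Context {K : fieldType}.
Variables (C E : bigraded K) (pair : forall i j, 'Hom(C i j, 'Hom(E j i, K^o))).
Hypothesis pair_post : forall i j j' (c : C i j) (e : E j' i),
  pair i j' (bpost C j j' c) e = pair i j c (bpre E j j' e).
Hypothesis pair_pre : forall i' i j (c : C i j) (e : E j i'),
  pair i' j (bpre C i' i c) e = pair i j c (bpost E i' i e).
Hypothesis pair_repr : forall i j (psi : 'Hom(C i j, K^o)),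
  exists e, forall c, pair i j c e = psi c.
Hypothesis pair_nondeg : forall i j e, (forall c, pair i j c e = 0) -> e = 0.
Variable b : nat.
Hypothesis C_bounded : forall i j : int,
  (b < `|i|)%N -> (b < `|j|)%N -> forall c : C i j, c = 0.

(* The degrees from [-b-1] to [b+1]: the support with one extra degree on either
   side, so that the neighbours of every degree that matters are indexed. *)
Let m : nat := (b.+1 + b.+2)%N.
Let deg (k : 'I_m) : int := k%:Z - b.+1%:Z.

Let deg_inj : injective deg.
Proof. by move=> k l /addIr[] /val_inj. Qed.

Let degP (i : int) : (`|i| <= b.+1)%N -> exists k, deg k = i.
Proof.
move=> le_i; have lt_m : (`|(i + b.+1%:Z)%R| < m)%N by rewrite /m; lia.
by exists (Ordinal lt_m); rewrite /deg /=; lia.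
Qed.

Let E_bounded (i j : int) : (b < `|i|)%N -> (b < `|j|)%N -> forall e : E j i, e = 0.
Proof.
by move=> bi bj e; apply: pair_nondeg => c; rewrite (C_bounded bi bj c) linear0 zero_lfunE.
Qed.

(** Adjointness and the cocycle condition turn the term of degree [k] into
    [v k + v k.+1]; the signs make the sum telescope, and both ends vanish because
    they lie outside the support. *)
Lemma supertrace_coboundary (f : forall i, C i i) (h : forall i, E i i)
    (s : forall i j, C i j) :
  (forall i j, bpost E i j (h i) = bpre E i j (h j)) ->
  (forall i j k : int, j = i + 1 -> i = k + 1 ->
    f i = bpost C k i (s i k) + bpre C i j (s j i)) ->
  \sum_(k < m) (-1) ^+ k * pair _ _ (f (deg k)) (h (deg k)) = 0.
Proof.
move=> hE fE.
pose u i := pair i (i - 1) (s i (i - 1)) (bpost E (i - 1) i (h (i - 1))).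
have uE (i k : int) : i = k + 1 -> u i = pair i k (s i k) (bpost E k i (h k)).
  by move=> ei; have ek : k = i - 1 by [rewrite ei addrK]; rewrite ek.
pose v (k : nat) : K := u (k%:Z - b.+1%:Z).
transitivity (\sum_(k < m) (-1) ^+ k * (v k + v k.+1)).
  apply: eq_bigr => k _; congr (_ * _).
  have ei : deg k = deg k - 1 + 1 by rewrite subrK.
  rewrite (fE _ (deg k + 1) (deg k - 1)) // linearD add_lfunE.
  rewrite pair_post pair_pre -hE /v -/(deg k); congr (_ + _).
  have -> : k.+1%:Z - b.+1%:Z = deg k + 1 by rewrite /deg; lia.
  by rewrite (uE _ (deg k)).
have u0 i : (b < `|i|)%N -> (b < `|(i - 1)%R|)%N -> u i = 0.
  by move=> bi bi'; rewrite /u (C_bounded bi bi' (s _ _)) linear0 zero_lfunE.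
rewrite alternating_telescope /v !u0 ?mulr0 ?subrr //; rewrite /m; lia.
Qed.

(** A cocycle [h] of [E] defines the functional [L c = sum_k (-1)^k <c_k, h_k>],
    which kills the cocycles of [C]: these are coboundaries by exactness.  By the
    Fredholm alternative [L] factors through the differential of [C], and the
    functionals obtained on the targets are represented by elements [G i j] of
    [E].  Reading the resulting identity degree by degree shows that, up to
    signs, [G] is a homotopy for [h]. *)
Theorem bexact_dual : bexact C -> bexact E.
Proof.
move=> exC h hE.
pose p := #|{: 'I_m * 'I_m}|.
pose src (l : 'I_p) := deg (enum_val l).1.
pose tgt (l : 'I_p) := deg (enum_val l).2.
pose V (k : 'I_m) : vectType K := C (deg k) (deg k).
pose W (l : 'I_p) : vectType K := C (src l) (tgt l).
pose D l (c : forall k, V k) : W l :=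
  bpost C (src l) (tgt l) (c (enum_val l).1) - bpre C (src l) (tgt l) (c (enum_val l).2).
pose L (c : forall k, V k) : K := \sum_(k < m) (-1) ^+ k * pair _ _ (c k) (h (deg k)).
have [a c c' c'' cE|c Dc|psi psiE] := @family_functional_factor K m p V W D L.
- split=> [|l].
    rewrite /L mulr_sumr -big_split; apply: eq_bigr => k _ /=.
    by rewrite cE linearP add_lfunE scale_lfunE mulrDr mulrCA.
  by rewrite /D !cE !linearP /= scalerN scalerBr addrACA.
- have [f [fc f0]] := @extend_family _ int deg (fun i => C i i) c (fun=> 0) deg_inj.
  rewrite /L; have [|s sE] := exC f; last first.
    rewrite -[RHS](supertrace_coboundary hE sE); apply: eq_bigr => k _.
    by rewrite fc.
  move=> i j; have [ej|neq] := eqVneq j (i + 1); last first.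
    by rewrite bpost_shape // bpre_shape // !zero_lfunE.
  have [/andP[bi bj]|] := boolP ((b < `|i|)%N && (b < `|j|)%N).
    by rewrite [LHS](C_bounded bi bj _) [RHS](C_bounded bi bj _).
  rewrite negb_and -!leqNgt => small.
  have [a ea] : exists a, deg a = i by apply: degP; lia.
  have [a' ea'] : exists a, deg a = j by apply: degP; lia.
  clear ej small; subst i j; rewrite !fc.
  have Dx (x : 'I_m * 'I_m) : bpost C (deg x.1) (deg x.2) (c x.1)
      = bpre C (deg x.1) (deg x.2) (c x.2).
    rewrite -(enum_rankK x); apply/eqP; rewrite -subr_eq0; apply/eqP.
    exact: Dc (enum_rank x).
  exact: Dx (a, a').
have {psi psiE}[e eE] : exists e : forall l : 'I_p, E (tgt l) (src l), forall c,
    L c = \sum_l pair _ _ (D l c) (e l).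
  pose e l := constructive_indefinite_description _ (pair_repr (psi l)).
  by exists (fun l => sval (e l)) => c; rewrite psiE; apply: eq_bigr => l _; rewrite (svalP (e l)).
pose ends (l : 'I_p) : int * int := (src l, tgt l).
have ends_inj : injective ends.
  move=> l l' [/deg_inj e1 /deg_inj e2]; apply: enum_val_inj.
  by case: (enum_val l) (enum_val l') e1 e2 => [? ?] [? ?] /= -> ->.
have [g [ge _]] := @extend_family _ (int * int)%type ends (fun q => E q.2 q.1) e
  (fun=> 0) ends_inj.
pose G (i j : int) : E j i := g (i, j).
have gE c : L c = \sum_(a < m) \sum_(a' < m) pair _ _
    (bpost C (deg a) (deg a') (c a) - bpre C (deg a) (deg a') (c a')) (G (deg a) (deg a')).
  rewrite eE pair_bigA /= (reindex (@enum_val (prod 'I_m 'I_m) predT)) /=; last first.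
    by exists enum_rank => x _; [apply: enum_valK | apply: enum_rankK].
  by apply: eq_bigr => l _; rewrite -ge.
have hk (k : 'I_m) : (-1) ^+ k *: h (deg k)
    = \sum_(a < m) bpre E (deg k) (deg a) (G (deg k) (deg a))
     - \sum_(a < m) bpost E (deg a) (deg k) (G (deg a) (deg k)).
  apply/eqP; rewrite -subr_eq0; apply/eqP; apply: pair_nondeg => c0.
  (* Test the identity on the family supported at the single degree [k]. *)
  have [|c [ck cz]] := @extend_family unit 'I_m (fun=> k) V (fun=> c0) (fun=> 0).
    by case=> -[].
  have {cz} c_off a : a != k -> c a = 0.
    by move=> neq; apply: cz => _ e'; rewrite e' eqxx in neq.
  have collapse (F : 'I_m -> K) : (forall a, a != k -> F a = 0) -> \sum_a F a = F k.
    by move=> F0; rewrite (bigD1 k) //= big1 ?addr0.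
  have {ck} ck : c k = c0 := ck tt.
  have := gE c; rewrite /L collapse => [|a neq]; last first.
    by rewrite c_off // linear0 zero_lfunE mulr0.
  have -> : \sum_(a < m) \sum_(a' < m) pair (deg a) (deg a')
      (bpost C (deg a) (deg a') (c a) - bpre C (deg a) (deg a') (c a'))
      (G (deg a) (deg a'))
    = \sum_(a < m) \sum_(a' < m)
        pair _ _ (c a) (bpre E (deg a) (deg a') (G (deg a) (deg a')))
    - \sum_(a < m) \sum_(a' < m)
        pair _ _ (c a') (bpost E (deg a) (deg a') (G (deg a) (deg a'))).
    rewrite -sumrB; apply: eq_bigr => a _; rewrite -sumrB; apply: eq_bigr => a' _.
    by rewrite linearB add_lfunE opp_lfunE pair_post pair_pre.
  rewrite [X in _ - X]exchange_big /= [X in X - _]collapse => [|a neq]; last first.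
    by rewrite big1 // => a' _; rewrite c_off // linear0 zero_lfunE.
  rewrite [X in _ - X]collapse => [|a neq]; last first.
    by rewrite big1 // => a' _; rewrite c_off // linear0 zero_lfunE.
  rewrite ck !linearB !linear_sum linearZ /= => e0.
  by apply/eqP; rewrite !sumrN in e0 *; rewrite -opprD subr_eq0; apply/eqP.
(* The exponent is the index of the degree [j], as in the signs of [L]. *)
exists (fun i j => (-1) ^+ `|(j + b.+1%:Z)%R|%N *: G j i) => i j k ej ei.
have [bi|le_ib] := ltnP b `|i|%N.
  by rewrite [LHS](E_bounded bi bi _) [RHS](E_bounded bi bi _).
have [x ex] : exists x, deg x = i by apply: degP; lia.
have [y ey] : exists x, deg x = j by apply: degP; lia.
have [z ez] : exists x, deg x = k by apply: degP; lia.
have hx := hk x; rewrite (bigD1 y) //= big1 ?addr0 in hx; last first.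
  move=> a neq; rewrite bpre_shape ?zero_lfunE // ex -ej -ey.
  by rewrite (inj_eq deg_inj).
rewrite (bigD1 z) //= big1 ?addr0 in hx; last first.
  move=> a neq; rewrite bpost_shape ?zero_lfunE // ex ei -ez.
  by rewrite (inj_eq (addIr 1)) (inj_eq deg_inj) eq_sym.
have sgn (a : 'I_m) : `|(deg a + b.+1%:Z)%R|%N = a by rewrite /deg subrK.
have exz : (x : nat) = z.+1 
  by have : deg x = deg z + 1 by [rewrite ex ez]; rewrite /deg; lia.
clear ej ei; subst i j k; rewrite !sgn.
have -> : h (deg x) = (-1) ^+ x *: ((-1) ^+ x *: h (deg x)).
  by rewrite scalerA -expr2 sqrr_sign scale1r.
rewrite hx scalerBr addrC; congr (_ + _); last by rewrite linearZ.
by rewrite exz exprS mulN1r scaleNr opprK linearZ.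
Qed.

End Duality.

(** * Serre duality for complexes of projectives *)

Section PerfectPairing.
Context {K : fieldType}.

Lemma functionals_separate (C : vectType K) (c : C) :
  (forall psi : 'Hom(C, K^o), psi c = 0) -> c = 0.
Proof.
move=> c0; rewrite (coord_vbasis (memvf c)) big1 // => i _.
have L : linear (fun x => coord (vbasis {:C}) i x : K^o) by move=> k u v; rewrite linearP.
have := c0 (linfun (fun x => coord (vbasis {:C}) i x : K^o)).
by rewrite linfun_linearE // => ->; rewrite scale0r.
Qed.

Lemma dim_dual (C : vectType K) : \dim {:'Hom(C, K^o)} = \dim {:C}.
Proof. by rewrite !dimvf; apply: muln1. Qed.

Definition flip_pairing (C E : vectType K) (beta : 'Hom(C, 'Hom(E, K^o))) :
    'Hom(E, 'Hom(C, K^o)) :=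
  linfun (fun e => linfun (fun c => beta c e)).

Lemma flip_pairingE (C E : vectType K) (beta : 'Hom(C, 'Hom(E, K^o))) e c :
  flip_pairing beta e c = beta c e.
Proof.
have L e' : linear (fun c => beta c e').
  by move=> k u v; rewrite linearP add_lfunE scale_lfunE.
rewrite linfun_linearE ?linfun_linearE // => k u v; apply/lfunP => d.
by rewrite add_lfunE scale_lfunE !linfun_linearE // linearP.
Qed.

(** Perfectness on one side gives perfectness on the other, by counting
    dimensions. *)
Lemma perfect_flip (C E : vectType K) (beta : 'Hom(C, 'Hom(E, K^o))) :
  (forall psi : 'Hom(C, K^o), exists e, forall c, beta c e = psi c) ->
  (forall e, (forall c, beta c e = 0) -> e = 0) ->
  (forall psi : 'Hom(E, K^o), exists c, forall e, beta c e = psi e) /\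
  (forall c, (forall e, beta c e = 0) -> c = 0).
Proof.
move=> repr nondeg.
have nondeg' c : (forall e, beta c e = 0) -> c = 0.
  by move=> c0; apply: functionals_separate => psi; have [e <-] := repr psi.
split=> // psi; suff : psi \in limg beta.
  by case/memv_imgP => c _ ->; exists c.
suff -> : limg beta = fullv by rewrite memvf.
apply/eqP; rewrite eqEdim subvf dim_dual /=.
pose gamma := flip_pairing beta.
have [kb kg] : lker beta = 0%VS /\ lker gamma = 0%VS.
  split; apply/eqP; rewrite -subv0; apply/subvP => u; rewrite memv_ker memv0 => /eqP u0.
    by apply/eqP/nondeg' => e; rewrite u0 zero_lfunE.
  by apply/eqP/nondeg => c; rewrite -flip_pairingE [LHS](_ : _ = gamma u c) // u0 zero_lfunE.
rewrite (limg_dim_eq (f := beta)) ?capfv // -(dim_dual C).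
rewrite -(limg_dim_eq (f := gamma) (U := fullv)) ?capfv //.
exact: dimvS (subvf _).
Qed.

End PerfectPairing.

Section HomSpaces.
Context {K : fieldType} {A : falgType K}.
Implicit Types M N L P : lmod A.

Definition homS M N : vectType K := subvs_of (hom_space M N).

Definition homS_of M N (f : 'Hom(M, N)) : homS M N := vsproj (hom_space M N) f.

Lemma homS_ofK M N (f : 'Hom(M, N)) : is_hom f -> vsval (homS_of f) = f.
Proof. by move=> fH; rewrite vsprojK //; apply/hom_spaceP. Qed.

Lemma homS_hom M N (f : homS M N) : is_hom (vsval f).
Proof. exact/hom_spaceP/subvsP. Qed.

Definition homS_post M N N' (d : 'Hom(N, N')) : 'Hom(homS M N, homS M N') :=
  linfun (fun f : homS M N => homS_of (d \o vsval f)%VF).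

Lemma homS_postE M N N' (d : 'Hom(N, N')) (f : homS M N) :
  is_hom d -> vsval (homS_post M d f) = (d \o vsval f)%VF.
Proof.
move=> dH; rewrite linfun_linearE.
  by rewrite homS_ofK //; apply: hom_comp => //; apply: homS_hom.
by move=> k u v; rewrite linearP /= comp_lfunDr -comp_lfunZr /homS_of linearP.
Qed.

Definition homS_pre M M' N (d : 'Hom(M', M)) : 'Hom(homS M N, homS M' N) :=
  linfun (fun f : homS M N => homS_of (vsval f \o d)%VF).

Lemma homS_preE M M' N (d : 'Hom(M', M)) (f : homS M N) :
  is_hom d -> vsval (homS_pre N d f) = (vsval f \o d)%VF.
Proof.
move=> dH; rewrite linfun_linearE.
  by rewrite homS_ofK //; apply: hom_comp => //; apply: homS_hom.
by move=> k u v; rewrite linearP /= comp_lfunDl -comp_lfunZl /homS_of linearP.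
Qed.

Lemma homS_post0 M N N' (f : homS M N) : homS_post M (0 : 'Hom(N, N')) f = 0.
Proof.
apply: subvs_inj; rewrite homS_postE ?comp_lfun0l ?linear0 //.
exact: zero_is_hom.
Qed.

Lemma homS_pre0 M M' N (f : homS M N) : homS_pre N (0 : 'Hom(M', M)) f = 0.
Proof.
apply: subvs_inj; rewrite homS_preE ?comp_lfun0r ?linear0 //.
exact: zero_is_hom.
Qed.

Definition hom_bigraded (X Y : complex A) : bigraded K.
Proof.
refine (@Bigraded K (fun i j => homS (X i) (Y j))
  (fun i j j' => homS_post (X i) (cdiff Y j j'))
  (fun i' i j => homS_pre (Y j) (cdiff X i' i)) _ _).
- move=> i j j' neq; apply/lfunP => f.
  by rewrite cdiff_shape // homS_post0 zero_lfunE.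
- move=> i' i j neq; apply/lfunP => f.
  by rewrite cdiff_shape // homS_pre0 zero_lfunE.
Defined.

Lemma Kvanish_bexact X Y : Kvanish X Y <-> bexact (hom_bigraded X Y).
Proof.
split=> [v f fd|ex f fC].
  have [|h hH fE] := v (fun i => vsval (f i)).
    split=> [i|i j]; first exact: homS_hom.
    have := congr1 vsval (fd i j).
    by rewrite /= homS_postE ?homS_preE //; apply: cdiff_hom.
  exists (fun i j => homS_of (h i j)) => i j k ej ei; apply: subvs_inj.
  rewrite linearD /= homS_postE ?homS_preE; try exact: cdiff_hom.
  by rewrite !homS_ofK // (fE i j k).
have [|h fE] := ex (fun i => homS_of (f i)).
  move=> i j; apply: subvs_inj; rewrite homS_postE ?homS_preE; try exact: cdiff_hom.
  by rewrite !homS_ofK ?fC.2 //; apply: fC.1.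
exists (fun i j => vsval (h i j)) => [i j|i j k ej ei]; first exact: homS_hom.
have := congr1 vsval (fE i j k ej ei); rewrite linearD /=.
rewrite homS_ofK; last exact: fC.1.
by rewrite homS_postE ?homS_preE //; apply: cdiff_hom.
Qed.

(** ** The trace pairing *)

Definition dual_basis_of P (projP : is_projective P) : seq (P * homA P) :=
  sval (constructive_indefinite_description _ (dual_basis projP)).

Lemma dual_basis_ofE P (projP : is_projective P) y :
  y = \sum_(p <- dual_basis_of projP) lact P (vsval p.2 y) p.1.
Proof. exact: (svalP (constructive_indefinite_description _ (dual_basis projP))). Qed.

Lemma dual_basis_functional P (projP : is_projective P) (xi : homA P) :
  xi = \sum_(p <- dual_basis_of projP) homA_act P (vsval xi p.1) p.2.
Proof.
apply: subvs_inj; apply/lfunP => y; rewrite {1}(dual_basis_ofE projP y).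
rewrite !linear_sum sum_lfunE; apply: eq_bigr => p _ /=.
have /hom_spaceP xiH := subvsP xi.
by rewrite homA_actE comp_lfunE xiH lregE lfunE.
Qed.

(** For [g : P -> Y] and [h : Y -> nu P] this is the trace of [h g], seen as an
    element of [Hom(P, nu P) = D Hom(P, P)]. *)
Definition trace_pairing P (projP : is_projective P) N :
    'Hom(homS P N, 'Hom(homS N (nak P), K^o)) :=
  linfun (fun g : homS P N => linfun (fun h : homS N (nak P) =>
    \sum_(p <- dual_basis_of projP)
      ((vsval h (vsval g p.1) : 'Hom(homA P, K^o)) p.2 : K^o))).

Lemma trace_pairingE P (projP : is_projective P) N (g : homS P N) h :
  trace_pairing projP N g h = \sum_(p <- dual_basis_of projP)
      ((vsval h (vsval g p.1) : 'Hom(homA P, K^o)) p.2 : K^o).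
Proof.
have L (g' : homS P N) : linear (fun h : homS N (nak P) => \sum_(p <- dual_basis_of projP)
      ((vsval h (vsval g' p.1) : 'Hom(homA P, K^o)) p.2 : K^o)).
  move=> k u v; rewrite scaler_sumr -big_split; apply: eq_bigr => p _ /=.
  by rewrite !add_lfunE !scale_lfunE.
rewrite linfun_linearE ?linfun_linearE // => k u v; apply/lfunP => w.
rewrite add_lfunE scale_lfunE !linfun_linearE // scaler_sumr -big_split.
apply: eq_bigr => p _ /=.
by rewrite add_lfunE scale_lfunE linearP add_lfunE scale_lfunE.
Qed.

Lemma trace_pairing_post P (projP : is_projective P) N N' (d : 'Hom(N, N')) g h :
  is_hom d -> trace_pairing projP N' (homS_post P d g) h
    = trace_pairing projP N g (homS_pre (nak P) d h).
Proof.
move=> dH; rewrite !trace_pairingE homS_postE // homS_preE //.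
by apply: eq_bigr => p _; rewrite !comp_lfunE.
Qed.

Lemma nak_actE P (a : A) (phi : nak P) xi :
  (lact (nak P) a phi : 'Hom(homA P, K^o)) xi
    = (phi : 'Hom(homA P, K^o)) (homA_act P a xi).
Proof. by rewrite [lact _ a _]dual_actE comp_lfunE. Qed.

(** Expanding [d x_k] in the dual basis of [Q] and collecting terms; for [P = Q]
    and [d = 1] this shows that the pairing is independent of the dual basis. *)
Lemma trace_pairing_pre P Q (projP : is_projective P) (projQ : is_projective Q) N
    (d : 'Hom(P, Q)) g h : is_hom d ->
  trace_pairing projP N (homS_pre N d g) h
    = trace_pairing projQ N g (homS_post N (nak_map d) h).
Proof.
move=> dH; have ndH := nak_map_hom dH.
rewrite !trace_pairingE homS_postE // homS_preE //.
transitivity (\sum_(p <- dual_basis_of projP) \sum_(q <- dual_basis_of projQ)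
    ((vsval h (vsval g q.1) : 'Hom(homA P, K^o))
       (homA_act P (vsval q.2 (d p.1)) p.2) : K^o)).
  apply: eq_bigr => p _; rewrite comp_lfunE {1}(dual_basis_ofE projQ (d p.1)).
  rewrite !linear_sum sum_lfunE; apply: eq_bigr => q _ /=.
  by rewrite (homS_hom g) (homS_hom h) nak_actE.
rewrite exchange_big; apply: eq_bigr => q _ /=; rewrite -linear_sum comp_lfunE.
rewrite dual_mapE comp_lfunE; congr (_ _).
rewrite [RHS](dual_basis_functional projP); apply: eq_bigr => p _.
by rewrite hom_to_A_mapE // comp_lfunE.
Qed.

Lemma orbit_comp_hom P N (y : N) (xi : homA P) :
  is_hom (orbit_map y \o (vsval xi : 'Hom(P, lreg A)))%VF.
Proof. exact: hom_comp (orbit_map_hom y) (homS_hom (xi : homS P (lreg A))). Qed.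

(** The functional [psi] is represented by the map sending [y] to the functional
    [xi |-> psi (xi(-) y)]. *)
Lemma trace_pairing_repr P (projP : is_projective P) N (psi : 'Hom(homS P N, K^o)) :
  exists h, forall g, trace_pairing projP N g h = psi g.
Proof.
pose F (y : N) (xi : homA P) : K^o := psi (homS_of (orbit_map y \o vsval xi)%VF).
have orbitL k (y z : N) : orbit_map (k *: y + z) = k *: orbit_map y + orbit_map z.
  by apply/lfunP => a; rewrite add_lfunE scale_lfunE !orbit_mapE linearP.
have F1 y : linear (F y).
  move=> k u v; rewrite /F /homS_of !linearP /=.
  by rewrite comp_lfunDr -comp_lfunZr !linearP.
have F2 : linear (fun y => linfun (F y) : 'Hom(homA P, K^o)).
  move=> k y z; apply/lfunP => xi; rewrite add_lfunE scale_lfunE !linfun_linearE //.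
  by rewrite /F /homS_of orbitL comp_lfunDl -comp_lfunZl !linearP.
pose h : 'Hom(N, nak P) := linfun (fun y => linfun (F y) : 'Hom(homA P, K^o)).
have hE y xi : (h y : 'Hom(homA P, K^o)) xi = F y xi by rewrite !linfun_linearE.
have hH : is_hom h.
  move=> a y; apply/lfunP => xi; rewrite nak_actE !hE /F; congr (psi (homS_of _)).
  apply/lfunP => x; rewrite homA_actE !comp_lfunE !orbit_mapE lfunE /=.
  by rewrite lactM comp_lfunE.
exists (homS_of h) => g; rewrite trace_pairingE homS_ofK //.
under eq_bigr => p _ do rewrite hE /F.
rewrite -linear_sum /=; congr (psi _); apply: subvs_inj; apply/lfunP => y.
rewrite linear_sum sum_lfunE {2}(dual_basis_ofE projP y) linear_sum.
apply: eq_bigr => p _ /=; rewrite homS_ofK; last exact: orbit_comp_hom.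
by rewrite comp_lfunE orbit_mapE (homS_hom g).
Qed.

Lemma trace_pairing_nondeg P (projP : is_projective P) N h :
  (forall g, trace_pairing projP N g h = 0) -> h = 0.
Proof.
move=> h0; apply: subvs_inj; apply/lfunP => y; rewrite linear0 zero_lfunE.
apply/lfunP => xi; have := h0 (homS_of (orbit_map y \o vsval xi)%VF).
rewrite zero_lfunE trace_pairingE homS_ofK => [<-|]; last exact: orbit_comp_hom.
rewrite {1}(dual_basis_functional projP xi) linear_sum; apply: eq_bigr => p _ /=.
by rewrite comp_lfunE orbit_mapE (homS_hom h) nak_actE.
Qed.

End HomSpaces.

Section Serre.
Context {K : fieldType} {A : falgType K}.
Variables P Y : complex A.
Hypotheses (projP : forall i, is_projective (P i)) (P_bounded : bounded P).

Let C := hom_bigraded P Y.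
Let E := hom_bigraded Y (nak_complex P).

Let homS_zero_dom (M N : lmod A) (f : homS M N) : is_zero M -> f = 0.
Proof. by move=> M0; apply: subvs_inj; apply: hom_zero_dom M0. Qed.

Let homS_zero_cod (M N : lmod A) (f : homS M N) : is_zero N -> f = 0.
Proof. by move=> N0; apply: subvs_inj; apply: hom_zero_cod N0. Qed.

(** For [P] projective the trace pairing is perfect, so each direction is an
    instance of [bexact_dual], the second one for the flipped pairing. *)
Theorem serre_duality : Kvanish P Y <-> Kvanish Y (nak_complex P).
Proof.
have [b P0] := P_bounded.
pose pair i j : 'Hom(C i j, 'Hom(E j i, K^o)) := trace_pairing (@projP i) (Y j).
have pair_post i j j' (c : C i j) (e : E j' i) :
    pair i j' (bpost C j j' c) e = pair i j c (bpre E j j' e).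
  exact/trace_pairing_post/cdiff_hom.
have pair_pre i' i j (c : C i j) (e : E j i') :
    pair i' j (bpre C i' i c) e = pair i j c (bpost E i' i e).
  exact/trace_pairing_pre/cdiff_hom.
have perf i j := perfect_flip (@trace_pairing_repr _ _ _ (@projP i) (Y j))
  (@trace_pairing_nondeg _ _ _ (@projP i) (Y j)).
rewrite !Kvanish_bexact; split.
  apply: (@bexact_dual _ C E pair pair_post pair_pre _ _ b) => [i j psi|i j e e0|i j bi _ c].
  - exact: trace_pairing_repr.
  - exact: trace_pairing_nondeg.
  - exact/homS_zero_dom/P0.
pose flip i j := flip_pairing (pair j i).
have flipE i j e c : flip i j e c = pair j i c e by apply: flip_pairingE.
apply: (@bexact_dual _ E C flip _ _ _ _ b) => [i j j' e c|i' i j e c|i j psi|i j c c0|i j bi bj e].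
- by rewrite !flipE pair_pre.
- by rewrite !flipE pair_post.
- by have [c cE] := (perf j i).1 psi; exists c => e; rewrite flipE cE.
- by apply: (perf j i).2 => e; rewrite -flipE.
- exact/homS_zero_cod/nak_zero/P0.
Qed.

End Serre.

(** * The Nakayama functor on the derived category *)

Section Nakayama.
Context {K : fieldType} {A : falgType K}.
Implicit Types X Y Z P : complex A.

Lemma bounded_projcx P : (forall i, is_projective (P i)) -> bounded P -> projcx P.
Proof.
move=> projP [b P0]; split=> //; exists b.+1%:Z => i le_bi; apply: P0; lia.
Qed.

Lemma is_nu_serre (X X' : Db A) Y : is_nu X X' -> Dvanish X Y -> Dvanish Y X'.
Proof.
move=> [P [f [projP /quasi_isoP qf /Db_iso_qiso nuP]]] v S SY.
have prP := bounded_projcx projP (Db_bounded P).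
have PX : resolution P X by split=> //; exists f => //; apply: cmap_chain.
apply: (Kvanish_target SY.1 nuP); apply/(serre_duality S projP (Db_bounded P)).
have [_ [s sC sQ]] := SY; rewrite (Kvanish_targetE prP sC sQ).
exact: v.
Qed.

Lemma is_nu_serre_inv (X X' : Db A) Y :
  is_nu X X' -> resolvable Y -> Dvanish Y X' -> Dvanish X Y.
Proof.
move=> [P [f [projP /quasi_isoP qf /Db_iso_qiso nuP]]] [S SY] v.
have prP := bounded_projcx projP (Db_bounded P).
have PX : resolution P X by split=> //; exists f => //; apply: cmap_chain.
apply: (Dvanish_resolution PX).
have [_ [s sC sQ]] := SY; rewrite -(Kvanish_targetE prP sC sQ).
apply/(serre_duality S projP (Db_bounded P)).
by apply: (Kvanish_target SY.1 (qiso_sym nuP)); apply: v.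
Qed.

Lemma is_nu_resolvable (X X' : Db A) : is_nu X X' -> resolvable X.
Proof.
move=> [P [f [projP /quasi_isoP qf _]]]; exists P; split.
  exact: bounded_projcx (Db_bounded P).
by exists f => //; apply: cmap_chain.
Qed.

Lemma Dhom0_0 X Y : Dhom0 X Y 0 <-> Dvanish X Y.
Proof.
by split; apply: Dvanish_target; [apply: shift0 | apply/qiso_sym/shift0].
Qed.

Section NuN.
Variable n : nat.

Lemma nu_n_resolvable (X X' : Db A) : is_nu_n n X X' -> resolvable X.
Proof. by move=> /is_nu_resolvable; apply: resolvable_unshift. Qed.

(** Serre duality in the form [Hom(X, Y[j]) = D Hom(Y, nu_n X[n - j])]. *)
Lemma nu_n_serre (X X' : Db A) Y (j k : int) :
  k = n%:Z - j -> is_nu_n n X X' -> Dhom0 X Y j -> Dhom0 Y X' k.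
Proof.
move=> ek nuX v.
have {}v : Dhom0 (shift X (- n%:Z)) Y (j - n%:Z).
  by apply/(@Dhom0_shift_source _ _ X Y (- n%:Z) _ j).
have {}v := is_nu_serre nuX v.
apply/(@Dhom0_shift_source _ _ Y X' (j - n%:Z) 0 k); first by rewrite ek; lia.
exact/Dhom0_0.
Qed.

Lemma nu_n_serre_inv (X X' : Db A) Y (j k : int) :
  k = n%:Z - j -> is_nu_n n X X' -> resolvable Y -> Dhom0 Y X' k -> Dhom0 X Y j.
Proof.
move=> ek nuX resY v.
have {}v : Dvanish (shift_complex Y (j - n%:Z)) X'.
  apply/Dhom0_0/(@Dhom0_shift_source _ _ Y X' (j - n%:Z) 0 k) => //.
  by rewrite ek; lia.
have {}v := is_nu_serre_inv nuX (resolvable_shift _ resY) v.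
by apply/(@Dhom0_shift_source _ _ X Y (- n%:Z) (j - n%:Z) j).
Qed.

(** Serre duality twice: [Hom(X, Y[j])] is dual to [Hom(Y, nu_n X[n - j])], which
    is dual to [Hom(nu_n X, nu_n Y[j])]. *)
Lemma nu_n_full (X X' Y Y' : Db A) (j : int) :
  is_nu_n n X X' -> is_nu_n n Y Y' -> Dhom0 X Y j -> Dhom0 X' Y' j.
Proof.
move=> nuX nuY v.
apply: (@nu_n_serre Y Y' X' (n%:Z - j)) => //; first by lia.
by apply: (@nu_n_serre X X' Y j).
Qed.

Lemma nu_n_faithful (X X' Y Y' : Db A) (j : int) :
  is_nu_n n X X' -> is_nu_n n Y Y' -> resolvable X' -> Dhom0 X' Y' j -> Dhom0 X Y j.
Proof.
move=> nuX nuY resX' v.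
apply: (@nu_n_serre_inv X X' Y j (n%:Z - j)) => //; first exact: nu_n_resolvable nuY.
by apply: (@nu_n_serre_inv Y Y' X' (n%:Z - j) j) => //; lia.
Qed.

Lemma nu_n_qiso_source (X Y X' : Db A) : qiso X Y -> is_nu_n n Y X' -> is_nu_n n X X'.
Proof.
move=> e [P [f [projP /quasi_isoP qf nuP]]].
have prP := bounded_projcx projP (Db_bounded P).
have [|_ [g gC gQ]] := @resolution_qiso _ _ P _ _ (qiso_shift (- n%:Z) (qiso_sym e)).
  by split=> //; exists f => //; apply: cmap_chain.
by exists P, (chain_pack gC); split=> //; apply/quasi_isoP.
Qed.

Lemma nu_n_exists (X : Db A) (R : Db A) :
  (forall i, is_projective (R i)) -> resolution R X -> exists X' : Db A, is_nu_n n X X'.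
Proof.
move=> projR [_ [f fC fQ]]; exists (nakD (shift R (- n%:Z))).
exists (shift R (- n%:Z)), (chain_pack (chain_shift (- n%:Z) fC)).
split=> [i||]; first exact: projR.
  exact/quasi_isoP/(qis_shift (- n%:Z) fQ).
exact: Db_iso_refl.
Qed.

End NuN.

(** * Modules as stalk complexes *)

Lemma zero_projective (M : lmod A) : is_zero M -> is_projective M.
Proof.
move=> M0 N N' p f _ _ _; exists 0; first exact: zero_is_hom.
by rewrite comp_lfun0r; apply: hom_zero_dom.
Qed.

Lemma lreg_stalk_projective (i : int) : is_projective (stalk_obj (lreg A) i).
Proof.
by case: i => [[|i]|i]; [apply: lreg_projective | |]; apply/zero_projective/zero_mod_zero.
Qed.

Lemma lreg_stalk_projcx : projcx (stalk_complex (lreg A)).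
Proof.
exact: (@bounded_projcx (stalk_complex (lreg A)) lreg_stalk_projective (stalk_bounded _)).
Qed.

(** Chain maps from the regular module in degree zero are cocycles of degree
    zero, and their homotopies are preimages under the differential. *)
Lemma Kvanish_lreg Z : Kvanish (stalk_complex (lreg A)) Z <-> acyc Z 0.
Proof.
split=> [v j k ej ek z dz|a0 f fC].
  pose f (i : int) : 'Hom(stalk_obj (lreg A) i, Z i) :=
    match i with Posz 0 => orbit_map (z : Z 0) | _ => 0 end.
  have fC : @is_chain _ _ (stalk_complex (lreg A)) Z f.
    apply: chainI => [[[|i]|i]|i l el]; try exact: zero_is_hom.
      exact: orbit_map_hom.
    rewrite /= comp_lfun0r; case: i el => [[|i]|i] el; rewrite ?comp_lfun0r //.
    apply/lfunP => x; rewrite zero_lfunE comp_lfunE orbit_mapE cdiff_hom.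
    by rewrite el -ej dz linear0.
  have [h hH fE] := v f fC; exists (h 0 k (1 : A)).
  have /lfunP/(_ (1 : A)) := fE 0 j k ej ek.
  rewrite /f add_lfunE !comp_lfunE zero_lfunE linear0 addr0 orbit_mapE lact1.
  by rewrite id_lfunE.
have dz : cdiff Z 0 1 (f 0 (1 : A)) = 0.
  by have /lfunP/(_ (1 : A)) := fC.2 0 1; rewrite /= comp_lfun0r zero_lfunE comp_lfunE.
have [|y ey] := a0 1 (- 1) erefl _ _ dz; first by rewrite addNr.
pose h (i j : int) : 'Hom(stalk_obj (lreg A) i, Z j) :=
  match i, j with Posz 0, Negz 0 => orbit_map (y : Z (Negz 0)) | _, _ => 0 end.
exists h => [[[|i]|i] [j|[|j]]|i j k ej ei]; try exact: zero_is_hom.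
  exact: orbit_map_hom.
rewrite /= comp_lfun0r addr0; case: i ej ei => [[|i]|i] ej ei.
- have -> : k = Negz 0 by lia.
  apply/lfunP => a; rewrite comp_lfunE orbit_mapE.
  by rewrite [LHS](hom_lregE _ (fC.1 0)) ey cdiff_hom.
- by rewrite comp_lfun0r; apply/hom_zero_dom/zero_mod_zero.
- by rewrite comp_lfun0r; apply/hom_zero_dom/zero_mod_zero.
Qed.

Lemma acyc_shift X (i j k : int) : k = i + j -> acyc (shift_complex X j) i <-> acyc X k.
Proof.
move=> ->; split=> a.
  move=> p q ep eq x; have {}ep : p = i + 1 + j by rewrite ep addrAC.
  have {eq} [q' eq eiq] : exists2 q', q = q' + j & i = q' + 1.
    exists (q - j); first by rewrite subrK.
    by apply: (addIr j); rewrite eq addrAC subrK.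
  subst p q => dx; have [|y ey] := a (i + 1) q' erefl eiq x.
    by rewrite /= scale_lfunE dx scaler0.
  by exists ((-1) ^+ `|j| *: y); rewrite ey /= scale_lfunE linearZ.
move=> p q ep eq x; rewrite /= scale_lfunE => /eqP.
rewrite scaler_eq0 signr_eq0 /= => /eqP dx.
have [||y ->] := a (p + j) (q + j) _ _ x dx; first by rewrite ep addrAC.
  by rewrite eq addrAC.
exists ((-1) ^+ `|j| *: y); rewrite scale_lfunE linearZ /= scalerA -expr2.
by rewrite sqrr_sign scale1r.
Qed.

Lemma Dhom0_lreg Y j : Dhom0 (stalk_complex (lreg A)) Y j <-> acyc Y j.
Proof.
rewrite -(@acyc_shift Y 0 j j) ?add0r // -Kvanish_lreg.
have res := resolution_self lreg_stalk_projcx.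
by split=> [v|]; [apply: v | apply: Dvanish_resolution].
Qed.

Section Subcomplex.
Variables (X : complex A) (U : forall i, {vspace X i}).
Hypothesis UA : forall i a x, x \in U i -> lact (X i) a x \in U i.
Hypothesis Ud : forall i j x, x \in U i -> cdiff X i j x \in U j.

Definition subcomplex_incl i : 'Hom(submod (@UA i), X i) := sub_incl (@UA i).

Lemma subcomplex_mem i j (u : submod (@UA i)) :
  (cdiff X i j \o subcomplex_incl i)%VF u \in U j.
Proof. by rewrite comp_lfunE; apply/Ud/sub_incl_mem. Qed.

Definition subcomplex : complex A.
Proof.
refine (Complex (fun i => submod (@UA i))
  (fun i j => sub_corestr (@UA j) (cdiff X i j \o subcomplex_incl i)%VF) _ _ _).
- move=> i j; apply: sub_corestr_hom; last exact: subcomplex_mem.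
  by apply: hom_comp; [apply: cdiff_hom | apply: sub_incl_hom].
- move=> i j neq; apply/lfunP => u; apply: (@sub_incl_inj _ _ _ _ (@UA j)).
  rewrite sub_corestrE; last exact: subcomplex_mem.
  by rewrite cdiff_shape // comp_lfun0l !zero_lfunE linear0.
- move=> i j k; apply/lfunP => u; apply: (@sub_incl_inj _ _ _ _ (@UA k)).
  rewrite comp_lfunE sub_corestrE; last exact: subcomplex_mem.
  rewrite comp_lfunE /subcomplex_incl sub_corestrE; last exact: subcomplex_mem.
  by rewrite comp_lfunE cdiffK zero_lfunE linear0.
Defined.

Lemma subcomplex_diffE i j u :
  subcomplex_incl j (cdiff subcomplex i j u) = cdiff X i j (subcomplex_incl i u).
Proof.
rewrite {1}/subcomplex_incl sub_corestrE; first by rewrite comp_lfunE.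
exact: subcomplex_mem.
Qed.

Lemma subcomplex_incl_chain : @is_chain _ _ subcomplex X subcomplex_incl.
Proof.
split=> [i|i j]; first exact: sub_incl_hom.
by apply/lfunP => u; rewrite [LHS]comp_lfunE [RHS]comp_lfunE; apply: subcomplex_diffE.
Qed.

End Subcomplex.

(** The truncation [tau_{<= 0} X] maps quasi-isomorphically to [X] and to the
    module [H^0(X)]. *)
Lemma acyc_qiso_stalk X : (forall i, i != 0 -> acyc X i) ->
  exists M : lmod A, qiso (stalk_complex M) X.
Proof.
move=> X0.
pose U (i : int) : {vspace X i} :=
  if i < 0 then fullv else if i == 0 then lker (cdiff X i (i + 1)) else 0%VS.
have Uneg (i : int) x : i < 0 -> x \in U i by rewrite /U => ->; rewrite memvf.
have UE (i : int) x : 0 <= i ->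
    (x \in U i) = if i == 0 then cdiff X i (i + 1) x == 0 else x == 0.
  by move=> i0; rewrite /U ltNge i0 /=; case: eqP => _; rewrite ?memv_ker ?memv0.
have UA i a x : x \in U i -> lact (X i) a x \in U i.
  have [i0|/Uneg U1 _] := leP 0 i; last exact: U1.
  rewrite !UE //; case: eqP => _ /eqP x0.
    by rewrite cdiff_hom x0 linear0.
  by rewrite x0 linear0.
have Ud i j x : x \in U i -> cdiff X i j x \in U j.
  have [ej|neq] := eqVneq j (i + 1); last by rewrite cdiff_shape // zero_lfunE mem0v.
  have [j0|/Uneg U1 _] := leP 0 j; last exact: U1.
  rewrite [_ \in U j]UE //; case: eqP => [_|jn0]; first by rewrite cdiffK eqxx.
  rewrite UE; last by lia.
  case: eqP => i0; first by rewrite -ej.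
  by move=> /eqP ->; rewrite linear0.
pose Z := subcomplex UA Ud.
pose inc := subcomplex_incl UA.
have incC : @is_chain _ _ Z X inc by apply: subcomplex_incl_chain.
have inc_inj i : injective (inc i) := @sub_incl_inj _ _ _ _ (@UA i).
have inc_mem i (u : Z i) : inc i u \in U i by apply: sub_incl_mem.
have lift i x : x \in U i -> exists u : Z i, inc i u = x by apply: sub_lift.
have Zpos (i : int) : 0 < i -> forall u : Z i, u = 0.
  move=> i0 u; apply: inc_inj; rewrite linear0; apply/eqP.
  by have := inc_mem i u; rewrite UE ?ltW // gt_eqF.
have dinc i j u : inc j (cdiff Z i j u) = cdiff X i j (inc i u) by apply: (chainE j u incC).
have incQ : @qis _ _ Z X inc.
  split=> i j k ej ei => [u y du e|y dy].
    have [i0|i0] := leP i 0; last by exists 0; rewrite linear0; apply: Zpos.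
    have [w ew] : exists w : Z k, inc k w = y by apply/lift/Uneg; lia.
    by exists w; apply: inc_inj; rewrite dinc ew.
  have [i0|i0] := leP i 0.
    have [u eu] : exists u : Z i, inc i u = y.
      apply: lift; case: (ltP i 0) => [/Uneg//|i0']; rewrite UE //.
      have -> : i == 0 by rewrite eq_le i0.
      by rewrite -ej dy.
    exists u, 0; rewrite linear0 addr0 eu; split=> //.
    by apply: inc_inj; rewrite dinc eu dy linear0.
  have [|x ->] := X0 i _ j k ej ei y dy; first by rewrite gt_eqF.
  by exists 0, x; rewrite !linear0 add0r.
pose B : {vspace Z 0} := limg (cdiff Z (- 1) 0).
have [|M [q [qH q_onto q_ker]]] := @quotient_exists _ _ (Z 0) B.
  move=> a x /memv_imgP[y _ ->]; rewrite -cdiff_hom.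
  exact: memv_img (memvf _).
pose f (i : int) : 'Hom(Z i, stalk_obj M i) :=
  match i with Posz 0 => q | _ => 0 end.
have fC : @is_chain _ _ Z (stalk_complex M) f.
  apply: chainI => [[[|i]|i]|i j ej]; try exact: zero_is_hom; first exact: qH.
  rewrite /= comp_lfun0l; case: j ej => [[|j]|j] ej; rewrite ?comp_lfun0l //.
  apply/lfunP => u; rewrite zero_lfunE comp_lfunE; apply/eqP; rewrite q_ker.
  have ei : i = - 1 by lia.
  clear ej; subst i; exact: memv_img (memvf _).
have fQ : @qis _ _ Z (stalk_complex M) f.
  split=> i j k ej ei => [u y du|y dy].
    have [i0|i0] := eqVneq i 0.
      have ek : k = - 1 by lia.
      clear ej ei; subst i k; rewrite zero_lfunE => e.
      have : u \in B by rewrite -q_ker; apply/eqP.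
      by case/memv_imgP => w _ ->; exists w.
    move=> _; have [pos|neg] := ltP 0 i; first by exists 0; rewrite linear0; apply: Zpos.
    have [|x ex] := X0 i i0 j k ej ei (inc i u).
      by rewrite -dinc du linear0.
    have [w ew] : exists w : Z k, inc k w = x by apply/lift/Uneg; lia.
    by exists w; apply: inc_inj; rewrite dinc ew.
  case: i j ej ei y dy => [[|i]|i] j ej ei y dy.
  - have [u ->] := q_onto y; exists u, 0; rewrite linear0 addr0; split=> //.
    by apply: Zpos; lia.
  - by exists 0, 0; rewrite !linear0 addr0; split=> //; apply: (is_zeroP _).1 zero_mod_zero y.
  - by exists 0, 0; rewrite !linear0 addr0; split=> //; apply: (is_zeroP _).1 zero_mod_zero y.
exists M, Z, f, inc; split=> //.
Qed.

(** ** The Nakayama functor on the regular module *)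

Definition rmult_map : 'Hom(rreg A, hom_to_A (lreg A)) :=
  linfun (fun a : A => vsproj (hom_space (lreg A) (lreg A)) (amulr a) : homA (lreg A)).

Lemma rmult_mapE (a : A) : vsval (rmult_map a : homA (lreg A)) = amulr a.
Proof.
rewrite linfun_linearE.
  by rewrite vsprojK //; apply/hom_spaceP => b x; rewrite !lregE !lfunE /= mulrA.
by move=> k b c; rewrite !linearP.
Qed.

Lemma rmult_map_onto (xi : homA (lreg A)) : xi = rmult_map (vsval xi (1 : A)).
Proof.
apply: subvs_inj; rewrite rmult_mapE; apply/lfunP => x.
have /hom_spaceP xiH := subvsP xi.
by rewrite (hom_lregE _ xiH) lregE lfunE.
Qed.

Lemma nak_lreg_iso : exists2 f : 'Hom(nak (lreg A), dual (rreg A)), is_hom f &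
  injective f /\ forall y, exists x, f x = y.
Proof.
exists (dual_map rmult_map).
  move=> a phi; apply/lfunP => b; rewrite [lact (dual _) a _]dual_actE !dual_mapE.
  rewrite !comp_lfunE; congr (fun_of_lfun _ _); apply: subvs_inj.
  by rewrite [LHS]homA_actE !rmult_mapE -rreg_actM [ract _ a b]lfunE.
split=> [phi psi e|psi].
  apply/lfunP => xi; rewrite (rmult_map_onto xi).
  by have /lfunP/(_ (vsval xi (1 : A))) := e; rewrite !dual_mapE !comp_lfunE.
have L : linear (fun xi : homA (lreg A) => (psi : 'Hom(A, K^o)) (vsval xi (1 : A))).
  by move=> k u v; rewrite linearP /= add_lfunE scale_lfunE linearP.
exists (linfun (fun xi : homA (lreg A) => (psi : 'Hom(A, K^o)) (vsval xi (1 : A)))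
  : 'Hom(homA (lreg A), K^o)).
apply/lfunP => a; rewrite dual_mapE comp_lfunE linfun_linearE // rmult_mapE.
by rewrite lfunE /= mul1r.
Qed.

Lemma is_nu_lreg : is_nu (stalk (lreg A)) (stalk (dual (rreg A))).
Proof.
have idC := chain_id (stalk_complex (lreg A)).
exists (stalk (lreg A)), (chain_pack idC); split.
- exact: lreg_stalk_projective.
- exact/quasi_isoP/qis_id.
have [f fH [f_inj f_onto]] := nak_lreg_iso.
pose F (i : int) : 'Hom(nak (stalk_obj (lreg A) i), stalk_obj (dual (rreg A)) i) :=
  match i with Posz 0 => f | _ => 0 end.
have z0 : is_zero (nak (zero_mod A)) by apply/nak_zero/zero_mod_zero.
have zn (x : nak (zero_mod A)) : x = 0 by apply: (is_zeroP _).1 z0 x.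
have zs (x : zero_mod A) : x = 0 by apply: (is_zeroP _).1 zero_mod_zero x.
have FC : @is_chain _ _ (nakD (stalk (lreg A))) (stalk (dual (rreg A))) F.
  split=> [[[|i]|i]|i j]; try exact: zero_is_hom; first exact: fH.
  by rewrite /= nak_map0 comp_lfun0l comp_lfun0r.
exists (nakD (stalk (lreg A))), (chain_pack (chain_id _)), (chain_pack FC).
split; apply/quasi_isoP; first exact: qis_id.
apply: (qis_bij FC) => [[[|i]|i]|[[|i]|i]].
- exact: f_inj.
- by move=> x y _; rewrite (zn x) (zn y).
- by move=> x y _; rewrite (zn x) (zn y).
- exact: f_onto.
- by move=> y; exists 0; rewrite linear0 (zs y).
- by move=> y; exists 0; rewrite linear0 (zs y).
Qed.

End Nakayama.

(** * The orbit of the regular module under [nu_n] *)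

Section Orbit.
Context {K : fieldType} {A : falgType K}.
Implicit Types X Y Z G H : Db A.
Variable n : nat.
Hypothesis hA : n_representation_infinite A n.

Local Notation Lam := (stalk (lreg A)).
Local Notation DLam := (stalk (dual (rreg A))).

(** [X] is [nu_n^-c] of the regular module, respectively [G] is [nu_n^k] of its
    dual. *)
Local Notation preproj c X := (is_nu_n_iter n c X Lam).
Local Notation preinj k G := (is_nu_n_iter n k DLam G).

Lemma module_resolution (M : lmod A) : exists R : Db A,
  (forall i, is_projective (R i)) /\ resolution R (stalk_complex M).
Proof.
have [P [[projP Ppos [f /quasi_isoP fQ]] Pneg]] := hA.1 M.
have Pb : bounded P.
  exists n => i bi; have [i0|i0] := ltP 0 i; first exact: Ppos.
  by apply: Pneg; lia.
exists (MkDb Pb); split=> //; split; first exact: bounded_projcx.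
by exists f => //; apply: cmap_chain.
Qed.

Lemma iter_full k X X' Y Y' j : is_nu_n_iter n k X X' -> is_nu_n_iter n k Y Y' ->
  Dhom0 X Y j -> Dhom0 X' Y' j.
Proof.
elim: k X Y => [|k IHk] X Y /=.
  move=> /Db_iso_qiso eX /Db_iso_qiso eY v.
  exact: Dhom0_source eX (Dhom0_target eY v).
move=> [X1 nuX itX] [Y1 nuY itY] v; apply: (IHk X1 Y1) => //.
exact: nu_n_full nuX nuY v.
Qed.

Lemma iter_snoc k X G G' :
  is_nu_n_iter n k X G -> is_nu_n n G G' -> is_nu_n_iter n k.+1 X G'.
Proof.
move=> itX nuG; elim: k X itX => [|k IHk] X /=.
  move=> /Db_iso_qiso e; exists G'; last exact: Db_iso_refl.
  exact: nu_n_qiso_source e nuG.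
by move=> [X1 nuX /IHk it1]; exists X1.
Qed.

Lemma iter_last k X G : is_nu_n_iter n k.+1 X G ->
  exists G' G'' : Db A, [/\ is_nu_n_iter n k X G', is_nu_n n G' G'' & qiso G'' G].
Proof.
elim: k X => [|k IHk] X.
  move=> [Z nuX /Db_iso_qiso e]; exists X, Z; split=> //; exact: Db_iso_refl.
move=> [Z nuX /IHk[G' [G'' [it1 nuG' e]]]].
by exists G', G''; split=> //; exists Z.
Qed.

Lemma iter_split p q X G : is_nu_n_iter n (p + q) X G ->
  exists2 G' : Db A, is_nu_n_iter n p X G' & is_nu_n_iter n q G' G.
Proof.
elim: p X => [|p IHp] X /=; first by exists X => //; apply: Db_iso_refl.
by move=> [Z nuX /IHp[G' it1 it2]]; exists G' => //; exists Z.
Qed.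

(** The special case of the regular module, which [nu] sends to its dual. *)
Lemma regular_serre (Y : Db A) j : Dhom0 Lam Y j -> Dhom0 Y DLam (- j).
Proof.
move=> v; apply/(@Dhom0_shift_source _ _ Y DLam j 0 (- j)); first by lia.
by apply/Dhom0_0; apply: (is_nu_serre is_nu_lreg).
Qed.

Lemma regular_serre_inv (Y : Db A) j :
  resolvable Y -> Dhom0 Y DLam (- j) -> Dhom0 Lam Y j.
Proof.
move=> resY v; apply: (is_nu_serre_inv is_nu_lreg); first exact: resolvable_shift.
by apply/Dhom0_0/(@Dhom0_shift_source _ _ Y DLam j 0 (- j)) => //; lia.
Qed.

Lemma regular_full Y Y' (j k : int) : k = j + n%:Z -> is_nu_n n Y Y' ->
  Dhom0 Lam Y j -> Dhom0 DLam Y' k.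
Proof.
move=> ek nuY /regular_serre; apply: (nu_n_serre _ nuY); lia.
Qed.

Lemma regular_faithful Y Y' (j k : int) : k = j + n%:Z -> is_nu_n n Y Y' ->
  Dhom0 DLam Y' k -> Dhom0 Lam Y j.
Proof.
move=> ek nuY v; apply: regular_serre_inv; first exact: nu_n_resolvable nuY.
have [R [_ res]] := module_resolution (dual (rreg A)).
by apply: (nu_n_serre_inv _ nuY _ v); [lia | exists R].
Qed.

Lemma preproj_resolvable c X : preproj c X -> resolvable X.
Proof.
case: c => [/Db_iso_qiso e|c [Z nuX _]]; last exact: nu_n_resolvable nuX.
apply: (resolvable_qiso (qiso_sym e)); exists Lam.
exact/resolution_self/lreg_stalk_projcx.
Qed.

(** Let [X] be a module representing [nu_n^-(k + 1)] of the regular module.  Then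
    [Hom(Lambda, X[j - n]) = 0], and applying [nu_n] once and then [k] more times
    carries [Lambda] to [G[-n]] and [X] to [Lambda]. *)
Lemma preinj_regular_vanish k G j : preinj k G -> j != n%:Z -> Dhom0 G Lam j.
Proof.
move=> itG jn; have [X [[Z nuX itZ] modX]] := hA.2 k.+1.
apply: (iter_full itG itZ); apply: (regular_full (j := j - n%:Z)) nuX _; first by lia.
by apply/Dhom0_lreg/acyclicP/modX; rewrite subr_eq0.
Qed.

(** For [k > 0] this is dual to [Hom(nu_n^(k - 1) D Lambda, Lambda[n - j]) = 0].  The objects
    [nu_n^k D Lambda] therefore lie in the module category. *)
Lemma regular_preinj_vanish k G j : preinj k G -> j != 0 -> Dhom0 Lam G j.
Proof.
case: k => [/Db_iso_qiso e|k /iter_last[G' [G'' [itG' nuG' e]]]] j0.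
  apply: (Dhom0_target e); apply/Dhom0_lreg => p q ep eq x _.
  case: j j0 {ep eq} x => [[|j]|j] // _ x; exists 0; rewrite linear0.
    exact: (is_zeroP _).1 zero_mod_zero x.
  exact: (is_zeroP _).1 zero_mod_zero x.
apply: (Dhom0_target e); apply: (nu_n_serre (j := n%:Z - j)) nuG' _; first by lia.
by apply: (preinj_regular_vanish itG'); lia.
Qed.

Lemma preinj_resolution k G : preinj k G -> exists R : Db A,
  (forall i, is_projective (R i)) /\ resolution R G.
Proof.
move=> itG; have [|M e] := @acyc_qiso_stalk _ _ G.
  by move=> i i0; apply/Dhom0_lreg; apply: regular_preinj_vanish itG i0.
have [R [projR res]] := module_resolution M.
by exists R; split=> //; apply: resolution_qiso e res.
Qed.

Lemma preinj_resolvable k G : preinj k G -> resolvable G.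
Proof. by move=> /preinj_resolution[R [_ res]]; exists R. Qed.

Lemma preinj_next k G : preinj k G -> exists2 G' : Db A, is_nu_n n G G' & preinj k.+1 G'.
Proof.
move=> itG; have [R [projR res]] := preinj_resolution itG.
have [G' nuG] := nu_n_exists n projR res.
by exists G' => //; apply: iter_snoc itG nuG.
Qed.

(** Applying [nu_n] to both arguments until the second one becomes the regular
    module. *)
Lemma preinj_preproj_vanish k b G Y j :
  preinj k G -> preproj b Y -> j != n%:Z -> Dhom0 G Y j.
Proof.
move=> itG itY jn; elim: b k G Y itG itY => [|b IHb] k G Y itG.
  move=> /Db_iso_qiso e; apply: (Dhom0_target (qiso_sym e)); exact: preinj_regular_vanish itG jn.
move=> [Y1 nuY itY1]; have [G' nuG itG'] := preinj_next itG.
apply: (nu_n_faithful nuG nuY (preinj_resolvable itG')); exact: IHb itG' itY1.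
Qed.

(** Every representative of [nu_n^-c] of the regular module lies in the module
    category, not just the one whose existence is assumed. *)
Lemma regular_preproj_vanish c Y j : preproj c Y -> j != 0 -> Dhom0 Lam Y j.
Proof.
case: c => [/Db_iso_qiso e|c [Y1 nuY itY1]] j0.
  apply: (Dhom0_target (qiso_sym e)); have [X [/Db_iso_qiso eX modX]] := hA.2 0%N.
  by apply: (Dhom0_target eX); apply/Dhom0_lreg/acyclicP/modX.
apply: (regular_faithful (k := j + n%:Z)) nuY _ => //.
apply: (@preinj_preproj_vanish 0 c) itY1 _; first exact: Db_iso_refl.
by rewrite -subr_eq0 addrK.
Qed.

(** [Hom(nu_n^-a, nu_n^-b[j]) = H^j(nu_n^-(b - a) Lambda)]. *)
Lemma preproj_preproj_vanish a b X Y j :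
  preproj a X -> preproj b Y -> (a <= b)%N -> j != 0 -> Dhom0 X Y j.
Proof.
elim: a b X Y => [|a IHa] b X Y.
  move=> /Db_iso_qiso e itY _ j0; apply: (Dhom0_source (qiso_sym e)).
  exact: regular_preproj_vanish itY j0.
move=> [X1 nuX itX]; case: b => // b [Y1 nuY itY] le_ab j0.
apply: (nu_n_faithful nuX nuY (preproj_resolvable itX)); exact: IHa itX itY le_ab j0.
Qed.

(** Serre duality exchanges the arguments at the cost of one application of
    [nu_n], which brings the exponents back to the previous case. *)
Lemma preproj_preproj_vanish_gt a b X Y j :
  preproj a X -> preproj b Y -> (b < a)%N -> j != n%:Z -> Dhom0 X Y j.
Proof.
case: a => // a [X1 nuX itX] itY le_ba jn.
apply: (nu_n_serre_inv (k := n%:Z - j)) nuX (preproj_resolvable itY) _ => //.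
by apply: preproj_preproj_vanish itY itX le_ba _; rewrite subr_eq0 eq_sym.
Qed.

Lemma preproj_preinj_vanish a k X G j : preproj a X -> preinj k G -> j != 0 -> Dhom0 X G j.
Proof.
elim: a k X G => [|a IHa] k X G.
  move=> /Db_iso_qiso e itG j0; apply: (Dhom0_source (qiso_sym e)).
  exact: regular_preinj_vanish itG j0.
move=> [X1 nuX itX] itG j0; have [G' nuG itG'] := preinj_next itG.
apply: (nu_n_faithful nuX nuG (preproj_resolvable itX)); exact: IHa itX itG' j0.
Qed.

(** Both objects are images under a common power of [nu_n] of objects one of which
    is the dual of the regular module; there Serre duality applies. *)
Lemma preinj_preinj_vanish k l G H j :
  preinj k G -> preinj l H -> j != 0 -> j != n%:Z -> Dhom0 G H j.
Proof.
move=> itG itH j0 jn; have [le_lk|/ltnW le_kl] := leqP l k.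
  have [G' itG' itG2] : exists2 G' : Db A, preinj (k - l) G' & is_nu_n_iter n l G' G.
    by apply: iter_split; rewrite subnK.
  apply: (iter_full itG2 itH); rewrite -[j]opprK; apply: regular_serre.
  by apply: regular_preinj_vanish itG' _; rewrite oppr_eq0.
have [H' itH' itH2] : exists2 H' : Db A, preinj (l - k) H' & is_nu_n_iter n k H' H.
  by apply: iter_split; rewrite subnK.
apply: (iter_full itG itH2); case: (l - k)%N itH' => [/Db_iso_qiso e|d].
  apply: (Dhom0_target e); rewrite -[j]opprK; apply: regular_serre.
  by apply: (@regular_preinj_vanish 0 DLam); [apply: Db_iso_refl | rewrite oppr_eq0].
move=> /iter_last[H1 [H2 [itH1 nuH1 e]]]; apply: (Dhom0_target e).
apply: (regular_full (j := j - n%:Z)) nuH1 _; first by lia.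
by apply: regular_preinj_vanish itH1 _; rewrite subr_eq0.
Qed.

Lemma preproj_module c : exists M : lmod A, preproj c (stalk M).
Proof.
case: c => [|c]; first by exists (lreg A); apply: Db_iso_refl.
have [X [[Z nuX itZ] modX]] := hA.2 c.+1.
have [|M e] := @acyc_qiso_stalk _ _ X; first by move=> i i0; apply/acyclicP/modX.
by exists M, Z => //; apply: (@nu_n_qiso_source _ _ n (stalk M) X Z).
Qed.

Lemma preproj_nonzero c (M : lmod A) : preproj c (stalk M) -> ~ is_zero M.
Proof.
move=> itM M0; have : Dhom0 Lam Lam 0.
  apply: (iter_full itM itM) => P _ f _.
  have S0 (i : int) : is_zero (shift_complex (stalk_complex M) 0 i).
    by rewrite /=; case: (i + 0) => [[|k]|k] //; apply: zero_mod_zero.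
  exists (fun i j => 0) => [i j|i j k _ _]; first exact: zero_is_hom.
  by rewrite [LHS](hom_zero_cod _ (S0 i)) [RHS](hom_zero_cod _ (S0 i)).
move=> /Dhom0_lreg/(_ 1 (- 1) erefl); rewrite addNr => /(_ erefl (1 : A)).
rewrite zero_lfunE => /(_ erefl)[y /eqP].
by rewrite zero_lfunE (negPf (oner_neq0 A)).
Qed.

End Orbit.

(** * Vanishing of [Hom] and [Ext] between modules *)

Section StalkMaps.
Context {K : fieldType} {A : falgType K}.
Implicit Types M N L : lmod A.

Definition stalk_map M N (u : 'Hom(M, N)) (i : int) :
    'Hom(stalk_obj M i, stalk_obj N i) :=
  match i with Posz 0 => u | _ => 0 end.

Lemma stalk_map_chain M N (u : 'Hom(M, N)) :
  is_hom u -> @is_chain _ _ (stalk_complex M) (stalk_complex N) (stalk_map u).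
Proof.
move=> uH; split=> [[[|i]|i]|i j]; try exact: zero_is_hom; first exact: uH.
by rewrite /= comp_lfun0l comp_lfun0r.
Qed.

Lemma stalk_map_comp M N L (v : 'Hom(N, L)) (u : 'Hom(M, N)) i :
  stalk_map (v \o u)%VF i = (stalk_map v i \o stalk_map u i)%VF.
Proof. by case: i => [[|i]|i] //=; rewrite comp_lfun0r. Qed.

Lemma stalk_mapD M N (u v : 'Hom(M, N)) i :
  stalk_map (u + v) i = stalk_map u i + stalk_map v i.
Proof. by case: i => [[|i]|i] //=; rewrite addr0. Qed.

Lemma stalk_map0 M N i : stalk_map (0 : 'Hom(M, N)) i = 0.
Proof. by case: i => [[|i]|i]. Qed.

Lemma stalk_map1 M i : stalk_map (\1%VF : 'End(M)) i = \1%VF.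
Proof.
by case: i => [[|i]|i] //=; apply/lfunP => x;
  rewrite (@zero_mod_eq0 _ A x) !linear0.
Qed.

Lemma Dhom0_hom M N (u : 'Hom(M, N)) P : proj_resolution P M ->
  Dhom0 (stalk_complex M) (stalk_complex N) 0 -> is_hom u -> u = 0.
Proof.
move=> [projP Ppos [f /quasi_isoP fQ]] v uH.
have PM : resolution P (stalk_complex M).
  split; last by exists f => //; apply: cmap_chain.
  by split=> //; exists 1 => i i1; apply: Ppos; lia.
have [|h hH hE] := (Dhom0_0 _ _).1 v P PM (fun i => stalk_map u i \o f i)%VF.
  exact: chain_comp (stalk_map_chain uH) (cmap_chain f).
(* A homotopy contributes nothing in degree zero: the stalk complex has zero
   differential and [P 1] vanishes. *)
have e0 : (u \o f 0 = 0)%VF.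
  have := hE 0 1 (- 1) erefl (esym (addNr 1)); rewrite /= comp_lfun0l add0r => ->.
  by rewrite [cdiff P 0 1](hom_zero_cod _ (Ppos 1 isT)) comp_lfun0r.
apply/lfunP => y; have [|x [z [_ ->]]] := fQ.2 0 1 (- 1) erefl (esym (addNr 1)) y.
  exact: zero_lfunE.
by rewrite [cdiff _ _ _ z]zero_lfunE addr0 -comp_lfunE e0 !zero_lfunE.
Qed.

(** A module placed in an arbitrary degree, read through the maps below, which
    are mutually inverse in the only degree where they matter. *)
Definition to_stalk N (i : int) : 'Hom(N, stalk_obj N i) :=
  match i with Posz 0 => \1%VF | _ => 0 end.

Definition of_stalk N (i : int) : 'Hom(stalk_obj N i, N) :=
  match i with Posz 0 => \1%VF | _ => 0 end.

Lemma to_stalk_hom N i : is_hom (to_stalk N i).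
Proof. by case: i => [[|i]|i]; [apply: hom_id | apply: zero_is_hom..]. Qed.

Lemma of_stalk_hom N i : is_hom (of_stalk N i).
Proof. by case: i => [[|i]|i]; [apply: hom_id | apply: zero_is_hom..]. Qed.

Lemma to_stalkK N i : i = 0 -> (of_stalk N i \o to_stalk N i = \1)%VF.
Proof. by move=> ->; rewrite /= comp_lfun1l. Qed.

Lemma Dhom0_Ext M N (i : nat) :
  Dhom0 (stalk_complex M) (stalk_complex N) i%:Z -> Ext_vanishes i M N.
Proof.
move=> v P [projP Ppos [e /quasi_isoP eQ]] f fH fd.
have PM : resolution P (stalk_complex M).
  split; last by exists e => //; apply: cmap_chain.
  by split=> //; exists 1 => k k1; apply: Ppos; lia.
have [|f' [f'E f'0]] := @extend_family unit int (fun=> - i%:Z) (fun k => 'Hom(P k, N))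
  (fun=> f) (fun=> 0); first by case=> -[].
have {}f'E : f' (- i%:Z) = f := f'E tt.
have f'cases k : k <> - i%:Z -> f' k = 0 by move=> neq; apply: f'0 => _ /esym.
have f'H k : is_hom (f' k).
  have [->|/eqP/f'cases ->] := eqVneq k (- i%:Z); first by rewrite f'E.
  exact: zero_is_hom.
pose F k : 'Hom(P k, stalk_obj N (k + i%:Z)) := (to_stalk N (k + i%:Z) \o f' k)%VF.
have [|h hH hE] := v P PM F.
  apply: chainI => [k|k j ej]; first by apply: hom_comp; [apply: to_stalk_hom |].
  rewrite /= scaler0 comp_lfun0l /F -comp_lfunA.
  have [ji|/eqP/f'cases ->] := eqVneq j (- i%:Z); last by rewrite comp_lfun0l comp_lfun0r.
  have -> : k = - i%:Z - 1 by rewrite -ji ej addrK.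
  by rewrite ji f'E fd comp_lfun0r.
have e0 : - i%:Z + i%:Z = 0 by rewrite addNr.
exists (of_stalk N (- i%:Z + i%:Z) \o h (- i%:Z + 1) (- i%:Z))%VF.
  by apply: hom_comp; [apply: of_stalk_hom | apply: hH].
have := hE (- i%:Z) (- i%:Z + 1) (- i%:Z - 1) erefl (esym (subrK _ _)).
rewrite /= scaler0 comp_lfun0l add0r /F f'E => FE.
by rewrite -comp_lfunA -FE comp_lfunA to_stalkK // comp_lfun1l.
Qed.

End StalkMaps.

(** * Additive closures *)

Section Factoring.
Context {K : fieldType} {A : falgType K}.
Implicit Types M N L : lmod A.
Implicit Types S T : mod_class A.

(** The ideal of homomorphisms factoring through finite sums of modules of [S].
    A module is in [add S] exactly when its identity lies in this ideal, which
    makes closure under sums, summands and isomorphisms a matter of composing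
    maps. *)
Inductive factors S M N : 'Hom(M, N) -> Prop :=
| Factors0 : factors S 0
| FactorsComp L (s : 'Hom(M, L)) (r : 'Hom(L, N)) :
    S L -> is_hom s -> is_hom r -> factors S (r \o s)%VF
| FactorsD (f g : 'Hom(M, N)) : factors S f -> factors S g -> factors S (f + g).

Definition generated S M : Prop := factors S (\1%VF : 'Hom(M, M)).

Lemma factors_hom S M N (f : 'Hom(M, N)) : factors S f -> is_hom f.
Proof.
elim=> [|L s r _ sH rH|u v _ uH _ vH]; [exact: zero_is_hom|exact: hom_comp|].
exact: hom_add.
Qed.

Lemma factors_comp S M M' N N' (f : 'Hom(M, N)) (a : 'Hom(M', M)) (b : 'Hom(N, N')) :
  is_hom a -> is_hom b -> factors S f -> factors S (b \o f \o a)%VF.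
Proof.
move=> aH bH; elim=> [|L s r SL sH rH|u v _ fu _ fv].
- by rewrite comp_lfun0r comp_lfun0l; apply: Factors0.
- rewrite comp_lfunA -[X in factors _ X]comp_lfunA.
  by apply: FactorsComp SL _ _; apply: hom_comp.
- by rewrite comp_lfunDr comp_lfunDl; apply: FactorsD.
Qed.

Lemma generated_self S M : S M -> generated S M.
Proof.
by move=> SM; have := FactorsComp SM (@hom_id _ _ M) (@hom_id _ _ M); rewrite comp_lfun1l.
Qed.

Lemma factors_sub S T M N (f : 'Hom(M, N)) :
  (forall L, S L -> generated T L) -> factors S f -> factors T f.
Proof.
move=> ST; elim=> [|L s r SL sH rH|u v _ fu _ fv]; first exact: Factors0.
  by have := factors_comp sH rH (ST L SL); rewrite comp_lfun1r.
exact: FactorsD.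
Qed.

Lemma generated_sub S T M :
  (forall L, S L -> generated T L) -> generated S M -> generated T M.
Proof. exact: factors_sub. Qed.

Lemma generated_retract S M N (s : 'Hom(M, N)) (r : 'Hom(N, M)) :
  is_hom s -> is_hom r -> (r \o s = \1)%VF -> generated S N -> generated S M.
Proof.
move=> sH rH rs gN; rewrite /generated -rs.
by have := factors_comp sH rH gN; rewrite comp_lfun1r.
Qed.

Lemma mod_iso_inv M N : mod_iso M N -> exists (f : 'Hom(M, N)) (g : 'Hom(N, M)),
  [/\ is_hom f, is_hom g, (g \o f = \1)%VF & (f \o g = \1)%VF].
Proof.
case=> f fH fbij; have fK : lker f == 0%VS by apply/lker0P; apply: bij_inj.
have gf : (f^-1 \o f = \1)%VF by apply: lker0_compVf.
have fg : (f \o f^-1 = \1)%VF.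
  have [g' _ fg'] := fbij; apply/lfunP => y; rewrite -(fg' y) comp_lfunE id_lfunE.
  by rewrite -[X in f X]comp_lfunE gf id_lfunE.
exists f, (f^-1)%VF; split=> // a y.
have /lfunP/(_ y) := fg; rewrite comp_lfunE id_lfunE => {1}<-.
by rewrite -fH -comp_lfunE gf id_lfunE.
Qed.

Lemma mod_iso_refl M : mod_iso M M.
Proof. by exists \1%VF; [apply: hom_id | exists id => x; rewrite id_lfunE]. Qed.

Lemma mod_iso_sym M N : mod_iso M N -> mod_iso N M.
Proof.
case/mod_iso_inv=> f [g [fH gH gf fg]]; exists g => //; exists f => x.
  by rewrite -comp_lfunE fg id_lfunE.
by rewrite -comp_lfunE gf id_lfunE.
Qed.

Lemma mod_iso_trans M N L : mod_iso M N -> mod_iso N L -> mod_iso M L.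
Proof.
move=> [f fH fb] [g gH gb]; exists (g \o f)%VF; first exact: hom_comp.
apply: (eq_bij (bij_comp gb fb)) => x; by rewrite comp_lfunE.
Qed.

Lemma generated_dsum S M N : generated S M -> generated S N -> generated S (dsum M N).
Proof.
move=> gM gN; pose i1 := dpair (\1%VF : 'Hom(M, M)) (0 : 'Hom(M, N)).
pose i2 := dpair (0 : 'Hom(N, M)) (\1%VF : 'Hom(N, N)).
have i1H : is_hom i1 by apply: dpair_hom; [apply: hom_id | apply: zero_is_hom].
have i2H : is_hom i2 by apply: dpair_hom; [apply: zero_is_hom | apply: hom_id].
have -> : generated S (dsum M N) = factors S
    ((i1 \o \1 \o dfst M N) + (i2 \o \1 \o dsnd M N))%VF.
  congr factors; apply/lfunP => u; rewrite add_lfunE !comp_lfunE !id_lfunE !dpairE.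
  rewrite dfstE dsndE !id_lfunE !zero_lfunE; case: u => x y.
  by congr (_, _); rewrite ?addr0 ?add0r.
by apply: FactorsD; apply: factors_comp => //; [apply: dfst_hom | apply: dsnd_hom].
Qed.

Lemma generated_zero S M : is_zero M -> generated S M.
Proof. by move=> M0; rewrite /generated (hom_zero_dom \1%VF M0); apply: Factors0. Qed.

Lemma add_generated S M : Defs.add S M -> generated S M.
Proof.
move=> [m [F [N [SF /mod_iso_inv[f [g [fH gH gf _]]]]]]].
apply: (@generated_retract _ _ (dsum M N) (dpair \1%VF 0) (dfst M N)).
- by apply: dpair_hom; [apply: hom_id | apply: zero_is_hom].
- exact: dfst_hom.
- by apply/lfunP => x; rewrite comp_lfunE dpairE dfstE.
apply: (generated_retract fH gH gf).
apply: (big_ind (fun L => generated S L)) => [|L L'|i _].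
- exact/generated_zero/zero_mod_zero.
- exact: generated_dsum.
- exact/generated_self/SF.
Qed.

Lemma iso_generated S M N : mod_iso M N -> generated S M -> generated S N.
Proof. by case/mod_iso_inv=> f [g [fH gH _ fg]]; apply: (generated_retract gH fH). Qed.

Lemma vee_generated S T R M :
  (forall L, S L -> generated R L) -> (forall L, T L -> generated R L) ->
  vee S T M -> generated R M.
Proof.
move=> SR TR /add_generated; apply: generated_sub => L.
by case=> C [] [N [sN _ ->]] LN; apply: (iso_generated LN); [apply: SR | apply: TR].
Qed.

Lemma sub_sub_split (V : zmodType) (a b c p q : V) :
  (a - (p + q)) - ((b - p) + (c - q)) = a - b - c.
Proof. by rewrite [b - p + _]addrACA -opprD opprB subrKA opprD addrA. Qed.

(** Vanishing in the derived category passes to generated modules: maps between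
    resolutions that lift a map factoring through [S] are, up to homotopy, sums
    of maps factoring through resolutions of modules of [S]. *)
Lemma generated_source S M (Z : complex A) :
  (forall L, S L -> resolvable (stalk_complex L)) ->
  (forall L, S L -> Dvanish (stalk_complex L) Z) ->
  generated S M -> Dvanish (stalk_complex M) Z.
Proof.
move=> resS vS genM P PM; have [projP [e eC eQ]] := PM.
suff key (u : 'Hom(M, M)) : factors S u -> forall t : forall i, 'Hom(P i, P i),
    is_chain t -> null (fun i => (e i \o t i)%VF - (stalk_map u i \o e i)%VF) ->
    forall f : forall i, 'Hom(P i, Z i), is_chain f -> null (fun i => f i \o t i)%VF.
  move=> f fC; apply: null_ext (key _ genM (fun=> \1%VF) (chain_id P) _ f fC) => [i|].
    by rewrite comp_lfun1r.
  exists (fun i j => 0) => [i j|i j k _ _]; first exact: zero_is_hom.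
  by rewrite stalk_map1 comp_lfun1l comp_lfun1r subrr comp_lfun0l comp_lfun0r addr0.
elim=> [|L s r SL sH rH|u1 u2 fu IHu fv IHv] t tC et f fC.
- apply: null_compl => //; apply: (lift_null projP eC eQ tC).
  by apply: null_ext et => i; rewrite stalk_map0 comp_lfun0l subr0.
- have [Q QL] := resS L SL; have [projQ [d dC dQ]] := QL.
  have sC := stalk_map_chain sH; have rC := stalk_map_chain rH.
  have [s' s'C ds'] := lift_map projP dC dQ (chain_comp sC eC).
  have [r' r'C er'] := lift_map projQ eC eQ (chain_comp rC dC).
  have rs'C := chain_comp r'C s'C.
  have trs : null (fun i => t i - (r' i \o s' i)%VF).
    apply: (lift_null projP eC eQ); first exact: chain_sub.
    have a1 := null_compr s'C er'; have a2 := null_compl rC ds'.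
    apply: null_ext (null_add et (null_opp (null_add a1 a2))) => i.
    rewrite !comp_lfunDl !comp_lfunDr !comp_lfunNl !comp_lfunNr stalk_map_comp !comp_lfunA.
    by rewrite subrKA opprB addrA subrK.
  apply: (@null_sub _ _ _ _ _ (fun i => (f i \o r' i) \o s' i)%VF).
    apply: null_ext (null_compl fC trs) => i.
    by rewrite comp_lfunDr comp_lfunNr comp_lfunA.
  apply: null_compr => //; apply: vS SL _ QL _ _.
  exact: chain_comp.
- have uC := stalk_map_chain (factors_hom fu); have vC := stalk_map_chain (factors_hom fv).
  have [t1 t1C et1] := lift_map projP eC eQ (chain_comp uC eC).
  have [t2 t2C et2] := lift_map projP eC eQ (chain_comp vC eC).
  have n1 := IHu _ t1C et1 f fC; have n2 := IHv _ t2C et2 f fC.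
  have t12C : is_chain (fun i => t i - t1 i - t2 i) by do 2!apply: chain_sub => //.
  have t12 : null (fun i => t i - t1 i - t2 i).
    apply: (lift_null projP eC eQ) => //.
    apply: null_ext (null_add et (null_opp (null_add et1 et2))) => i.
    rewrite stalk_mapD !comp_lfunDr !comp_lfunNr comp_lfunDl.
    exact: sub_sub_split.
  apply: null_ext (null_add (null_compl fC t12) (null_add n1 n2)) => i.
  by rewrite !comp_lfunDr !comp_lfunNr -[_ - _ - _]addrA -opprD subrK.
Qed.

Lemma generated_target S M (P : complex A) (k : int) :
  (forall L, S L -> Kvanish P (shift_complex (stalk_complex L) k)) ->
  generated S M -> Kvanish P (shift_complex (stalk_complex M) k).
Proof.
move=> vS genM f fC.
suff key (u : 'Hom(M, M)) : factors S u ->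
    null (X := P) (Y := shift_complex (stalk_complex M) k)
      (fun i => stalk_map u (i + k) \o f i)%VF.
  by apply: null_ext (key _ genM) => i; rewrite stalk_map1 comp_lfun1l.
elim=> [|L s r SL sH rH|u1 u2 _ IHu _ IHv].
- exists (fun i j => 0) => [i j|i j l _ _]; first exact: zero_is_hom.
  by rewrite stalk_map0 comp_lfun0l comp_lfun0r comp_lfun0l addr0.
- have sC := chain_shift k (stalk_map_chain sH).
  have rC := chain_shift k (stalk_map_chain rH).
  have n := null_compl rC (vS L SL _ (chain_comp sC fC)).
  by apply: null_ext n => i; rewrite stalk_map_comp comp_lfunA.
- by apply: null_ext (null_add IHu IHv) => i; rewrite stalk_mapD comp_lfunDl.
Qed.

Lemma generated_Dhom0 S M N (k : int) :
  (forall L, S L -> resolvable (stalk_complex L)) ->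
  (forall L L', S L -> S L' -> Dhom0 (stalk_complex L) (stalk_complex L') k) ->
  generated S M -> generated S N -> Dhom0 (stalk_complex M) (stalk_complex N) k.
Proof.
move=> resS vS genM genN; apply: (generated_source resS) genM => L SL P PL.
by apply: generated_target genN => L' SL'; apply: (vS L L').
Qed.

End Factoring.

(** * Indecomposable summands *)

Section Indecomposables.
Context {K : fieldType} {A : falgType K}.
Implicit Types M N L : lmod A.

Lemma mod_iso_dsum_trans M N N' L L' : mod_iso M (dsum N N') ->
  mod_iso N (dsum L L') -> mod_iso M (dsum L (dsum L' N')).
Proof.
move=> [f fH [f' fK f'K]] [g gH [g' gK g'K]].
pose a := (g \o (dfst N N' \o f))%VF.
have aH : is_hom a by apply: hom_comp => //; apply: hom_comp => //; apply: dfst_hom.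
pose h : 'Hom(M, dsum L (dsum L' N')) :=
  dpair (dfst L L' \o a)%VF (dpair (dsnd L L' \o a)%VF (dsnd N N' \o f)%VF).
have hE x : h x = ((g (f x).1).1, ((g (f x).1).2, (f x).2)).
  by rewrite !dpairE !comp_lfunE !dfstE !dsndE.
exists h.
  apply: dpair_hom; first by apply: hom_comp => //; apply: dfst_hom.
  by apply: dpair_hom; apply: hom_comp => //; apply: dsnd_hom.
exists (fun z : L * (L' * N') => f' (g' (z.1, z.2.1), z.2.2)) => [x|[x [y z]]].
  by rewrite hE /= -surjective_pairing gK -surjective_pairing fK.
by rewrite hE f'K /= g'K.
Qed.

Lemma dim_dsum M N : \dim {:dsum M N} = (\dim {:M} + \dim {:N})%N.
Proof. by rewrite !dimvf. Qed.

Lemma mod_iso_dim M N : mod_iso M N -> \dim {:M} = \dim {:N}.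
Proof.
move=> [f _ [f' fK f'K]]; have f0 : lker f == 0%VS by apply/lker0P; apply: can_inj fK.
rewrite -(limg_dim_eq (f := f) (U := fullv)) ?(eqP f0) ?capv0 //; congr (\dim _).
apply/eqP; rewrite eqEsubv subvf; apply/subvP => y _.
by rewrite -(f'K y) memv_img ?memvf.
Qed.

Lemma mod_iso_dsum0 M : mod_iso M (dsum M (zero_mod A)).
Proof.
exists (dpair \1%VF 0).
  by apply: dpair_hom; [apply: hom_id | apply: zero_is_hom].
exists (fun z : M * zero_mod A => z.1) => [x|[x y]]; rewrite dpairE id_lfunE //=.
by rewrite zero_lfunE (@zero_mod_eq0 _ A y).
Qed.

(** Splitting off nonzero summands lowers the dimension. *)
Lemma indecomposable_summand M : ~ is_zero M ->
  exists N N', indecomposable N /\ mod_iso M (dsum N N').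
Proof.
have [d] := ubnP (\dim {:M}); elim: d M => // d IHd M le_d Mn0.
have [[L [L' [e Ln0 L'n0]]]|noL] := classic (exists L L' : lmod A,
    [/\ mod_iso M (dsum L L'), ~ is_zero L & ~ is_zero L']).
  have [|N [N' [indN eN]]] := IHd L _ Ln0; last first.
    by exists N, (dsum N' L'); split=> //; apply: mod_iso_dsum_trans e eN.
  move: le_d; rewrite (mod_iso_dim e) dim_dsum ltnS; apply: leq_trans.
  by rewrite -addn1 leq_add2l lt0n; apply/eqP.
exists M, (zero_mod A); split.
  split=> // L L' e; have [|Ln0] := classic (is_zero L); first by left.
  have [|L'n0] := classic (is_zero L'); first by right.
  by case: noL; exists L, L'.
exact: mod_iso_dsum0.
Qed.

Lemma add_summand (S : mod_class A) M N N' : S M -> mod_iso M (dsum N N') -> Defs.add S N.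
Proof.
move=> SM e; exists 1%N, (fun=> M), N'; split=> //.
rewrite /bigdsum big_ord_recl big_ord0.
exact: mod_iso_trans (mod_iso_sym e) (mod_iso_dsum0 M).
Qed.

End Indecomposables.

(** * Infinitude and vanishing of extensions *)

Section Main.
Context {K : fieldType} {A : falgType K}.
Variable n : nat.
Hypotheses (n_gt0 : (1 <= n)%N) (hA : n_representation_infinite A n).

Local Notation PvI := (vee (preprojectives A n) (preinjectives A n)).

(** Treating both classes at once, so that vanishing has to be checked only on
    pairs of generators. *)
Let orbit (M : lmod A) : Prop :=
  (exists i, is_nu_n_iter n i (stalk M) (stalk (lreg A))) \/
  (exists i, is_nu_n_iter n i (stalk (dual (rreg A))) (stalk M)).

Lemma PvI_generated (M : lmod A) : PvI M -> generated orbit M.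
Proof.
apply: vee_generated => L /add_generated; apply: generated_sub => L' [i it].
  by apply: generated_self; left; exists i.
by apply: generated_self; right; exists i.
Qed.

Lemma orbit_vanish (M N : lmod A) (i : nat) : (0 < i < n)%N -> orbit M -> orbit N ->
  Dhom0 (stalk_complex M) (stalk_complex N) i%:Z.
Proof.
move=> /andP[i0 i_n] [[a itM]|[a itM]] [[b itN]|[b itN]].
- have [le_ab|lt_ba] := leqP a b.
    by apply: (preproj_preproj_vanish hA itM itN) => //; lia.
  by apply: (preproj_preproj_vanish_gt hA itM itN) => //; lia.
- by apply: (preproj_preinj_vanish hA itM itN); lia.
- by apply: (preinj_preproj_vanish hA itM itN); lia.
- by apply: (preinj_preinj_vanish hA itM itN); lia.
Qed.

Lemma ind_PvI_Ext (i : nat) (C C' : mod_class A) (X Y : lmod A) :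
  (0 < i < n)%N -> ind PvI C -> ind PvI C' -> C X -> C' Y -> Ext_vanishes i X Y.
Proof.
move=> i_n [M [pM _ ->]] [N [pN _ ->]] eX eY; apply: Dhom0_Ext.
have gX := iso_generated eX (PvI_generated pM).
have gY := iso_generated eY (PvI_generated pN).
apply: generated_Dhom0 gX gY => [L _|L L']; last exact: orbit_vanish.
by have [R [_ res]] := module_resolution hA L; exists R.
Qed.

(** A common summand would give a nonzero map [nu_n^-a -> nu_n^-b], and there is
    none for [b < a]. *)
Lemma no_common_summand (a b : nat) (M M' N N' L L' : lmod A) : (b < a)%N ->
  is_nu_n_iter n a (stalk M) (stalk (lreg A)) ->
  is_nu_n_iter n b (stalk N) (stalk (lreg A)) ->
  mod_iso M (dsum L M') -> mod_iso N (dsum L' N') -> mod_iso L L' -> is_zero L.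
Proof.
move=> lt_ba itM itN /mod_iso_inv[f [f' [fH f'H _ ff']]].
move=> /mod_iso_inv[g [g' [gH g'H _ gg']]] /mod_iso_inv[t [t' [tH t'H t't _]]].
pose i1 := dpair (\1%VF : 'Hom(L, L)) (0 : 'Hom(L, M')).
have i1H : is_hom i1 by apply: dpair_hom; [apply: hom_id | apply: zero_is_hom].
pose j1 := dpair (\1%VF : 'Hom(L', L')) (0 : 'Hom(L', N')).
have j1H : is_hom j1 by apply: dpair_hom; [apply: hom_id | apply: zero_is_hom].
pose u : 'Hom(M, N) := (g' \o (j1 \o (t \o (dfst L M' \o f))))%VF.
have uH : is_hom u by do 4!apply: hom_comp => //; apply: dfst_hom.
have v : Dhom0 (stalk_complex M) (stalk_complex N) 0.
  by apply: (preproj_preproj_vanish_gt hA itM itN) => //; lia.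
have [P [PM _]] := hA.1 M; have /lfunP u0 := Dhom0_hom PM v uH.
apply/is_zeroP => x; have := u0 (f' (i1 x)).
rewrite !comp_lfunE zero_lfunE -[f (f' _)]comp_lfunE ff' id_lfunE dfstE dpairE /= id_lfunE.
move=> /(congr1 g); rewrite -comp_lfunE gg' id_lfunE linear0 dpairE id_lfunE.
by move=> [tx _]; rewrite -[x]id_lfunE -t't comp_lfunE tx linear0.
Qed.

(** Choosing an indecomposable summand of each of [m + 1] members of the orbit and
    applying the pigeonhole principle. *)
Lemma ind_PvI_infinite : ~ finite_collection (ind PvI).
Proof.
move=> [m [F FP]].
pose Q (c : nat) (i : 'I_m) := exists M N N' : lmod A,
  [/\ is_nu_n_iter n c (stalk M) (stalk (lreg A)), indecomposable N,
      mod_iso M (dsum N N') & F i = iso_class N].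
have exQ c : exists i, Q c i.
  have [M itM] := preproj_module hA c.
  have [N [N' [indN e]]] := indecomposable_summand (preproj_nonzero itM).
  have pN : preprojectives A n N by apply: add_summand e; exists c.
  have NN := mod_iso_dsum0 N.
  have [|i Fi] := FP (iso_class N); last by exists i, M, N, N'.
  exists N; split=> //; apply: (add_summand _ NN).
  by exists (iso_class N); [left; exists N | apply: mod_iso_refl].
pose s (c : 'I_m.+1) := sval (constructive_indefinite_description _ (exQ c)).
have sP (c : 'I_m.+1) : Q c (s c) := svalP (constructive_indefinite_description _ (exQ c)).
have : ~~ injectiveb s.
  by apply/negP => /injectiveP/leq_card; rewrite !card_ord ltnn.
move=> /injectivePn[a [b neq e]].
wlog lt_ba : a b neq e / (b < a)%N.
  move=> W; case: (ltngtP b a) => [|lt_ab|eab]; first exact: W.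
    by apply: (W b a) => //; rewrite eq_sym.
  by case/eqP: neq; apply: val_inj.
have [M [L [M' [itM [Ln0 _] eM FM]]]] := sP a.
have [N [L' [N' [itN _ eN FN]]]] := sP b.
apply: Ln0; apply: (no_common_summand lt_ba itM itN eM eN).
suff : iso_class L L' by [].
by rewrite -FM e FN; apply: mod_iso_refl.
Qed.

End Main.

Theorem corollary4p10 (n : nat) (K : fieldType) (A : falgType K)
    (hn : (1 <= n)%N) (hA : n_representation_infinite A n) :
  let PvI : mod_class A := vee (preprojectives A n) (preinjectives A n) in
  ~ finite_collection (ind PvI) /\
  forall (i : nat) (C C' : mod_class A) (X Y : lmod A),
    (0 < i < n)%N -> ind PvI C -> ind PvI C' -> C X -> C' Y ->
    Ext_vanishes i X Y.
Proof.
move=> PvI; split; first exact: ind_PvI_infinite hn hA.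
exact: ind_PvI_Ext hA.
Qed.
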